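(* Let $0<p<1$. The $p$-Banach space $\mathcal{F}_{p}([0,1])$ has a Schauder basis but does not have an unconditional basis.
   Context: Let $0<p\le 1$. A $p$-metric on a set $\mathcal{M}$ is a symmetric map $d\colon\mathcal{M}\times\mathcal{M}\to[0,\infty)$ with $d(x,y)=0$ iff $x=y$ and $d^p(x,y)\le d^p(x,z)+d^p(z,y)$ for all $x,y,z$ (every metric is a $p$-metric). A $p$-Banach space is a complete real vector space with a $p$-norm, i.e. a quasi-norm with $\|x+y\|^p\le\|x\|^p+\|y\|^p$. For a $p$-metric space $\mathcal{M}$ with base point $0$, the Lipschitz free $p$-space $\mathcal{F}_p(\mathcal{M})$ is the $p$-Banach space, unique up to linear isometry, with an isometric embedding $\delta_{\mathcal{M}}\colon\mathcal{M}\to\mathcal{F}_p(\mathcal{M})$, $\delta_{\mathcal{M}}(0)=0$, such that for every $p$-Banach space $X$ and every Lipschitz map $f\colon\mathcal{M}\to X$ with $f(0)=0$ there is a unique bounded linear map $T_f\colon\mathcal{F}_p(\mathcal{M})\to X$ with $T_f\circ\delta_{\mathcal{M}}=f$, and $\|T_f\|=\mathrm{Lip}(f)$. The linear span of $\delta_{\mathcal{M}}(\mathcal{M})$ is dense in $\mathcal{F}_p(\mathcal{M})$. Here $[0,1]$ carries the Euclidean metric. A Schauder basis is unconditional if all basis expansions converge unconditionally. *)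

(* Defs.v *)
From HB Require Import structures.
From mathcomp Require Import all_boot all_order all_algebra.
From mathcomp Require Import all_classical all_reals all_analysis.
Import Order.TTheory GRing.Theory Num.Theory.
Import numFieldNormedType.Exports.
Set Implicit Arguments.
Unset Strict Implicit.
Unset Printing Implicit Defensive.
Local Open Scope classical_set_scope.
Local Open Scope ring_scope.

(* The quasi-triangle inequality, with constant 2 `^ (p^-1 - 1), follows from
   [pnorm_triangle] when 0 < p <= 1. The library's normed modules, whose norm
   is subadditive, do not cover the case p < 1. *)
HB.mixin Record Lmodule_isPNormed (R : realType) (p : R) V
    & GRing.Lmodule R V := {
  pnorm : V -> R ;
  pnorm_ge0 : forall x, 0 <= pnorm x ;
  pnorm_eq0 : forall x, pnorm x = 0 -> x = 0 ;
  pnormZ : forall (a : R) x, pnorm (a *: x) = `|a| * pnorm x ;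
  pnorm_triangle :
    forall x y, pnorm (x + y) `^ p <= pnorm x `^ p + pnorm y `^ p
}.

#[short(type="pNormedType")]
HB.structure Definition PNormed (R : realType) (p : R) :=
  {V of GRing.Lmodule R V & Lmodule_isPNormed R p V}.

Definition pnorm_cvg (R : realType) (p : R) (V : pNormedType p)
    (u : nat -> V) (l : V) : Prop :=
  (fun n => pnorm (u n - l)) @ \oo --> (0 : R).

Definition pnorm_cauchy (R : realType) (p : R) (V : pNormedType p)
    (u : nat -> V) : Prop :=
  forall e : R, 0 < e ->
    exists N : nat, forall m n : nat,
      (N <= m)%N -> (N <= n)%N -> pnorm (u m - u n) < e.

HB.mixin Record PNormed_isComplete (R : realType) (p : R) V
    & PNormed R p V := {
  pnorm_complete :
    forall u : nat -> V, pnorm_cauchy u -> exists l, pnorm_cvg u l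
}.

#[short(type="pBanachType")]
HB.structure Definition PBanach (R : realType) (p : R) :=
  {V of PNormed R p V & PNormed_isComplete R p V}.

Record pMetricSpace (R : realType) (p : R) := PMetricSpace {
  point_of :> Type ;
  pdist : point_of -> point_of -> R ;
  base_point : point_of ;
  pdist_ge0 : forall x y, 0 <= pdist x y ;
  pdist_eq0 : forall x y, pdist x y = 0 <-> x = y ;
  pdist_sym : forall x y, pdist x y = pdist y x ;
  pdist_triangle : forall x y z,
    pdist x y `^ p <= pdist x z `^ p + pdist z y `^ p
}.

Definition is_lipschitz (R : realType) (p : R) (M : pMetricSpace p)
    (X : pNormedType p) (f : M -> X) : Prop :=
  exists L : R, forall x y, pnorm (f x - f y) <= L * pdist x y.

(* Meaningful under [is_lipschitz f]; it is 0 when M is a single point, since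
   [sup set0 = 0]. *)
Definition lip_const (R : realType) (p : R) (M : pMetricSpace p)
    (X : pNormedType p) (f : M -> X) : R :=
  sup [set r | exists x y, x <> y /\ r = pnorm (f x - f y) / pdist x y].

Definition is_bounded (R : realType) (p : R) (X Y : pNormedType p)
    (T : X -> Y) : Prop :=
  exists C : R, forall x, pnorm (T x) <= C * pnorm x.

(* Meaningful under [is_bounded T]. *)
Definition op_norm (R : realType) (p : R) (X Y : pNormedType p)
    (T : X -> Y) : R :=
  sup [set pnorm (T x) | x in [set x | pnorm x <= 1]].

(* [F], with the map [delta], is the Lipschitz free p-space over [M]; it is
   determined by this property up to a linear isometry commuting with the
   maps [delta]. *)
Definition is_lipschitz_free (R : realType) (p : R) (M : pMetricSpace p)
    (F : pBanachType p) (delta : M -> F) : Prop :=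
  [/\ forall x y, pnorm (delta x - delta y) = pdist x y,
      delta (base_point M) = 0 &
      forall (X : pBanachType p) (f : M -> X),
        is_lipschitz f -> f (base_point M) = 0 ->
        exists T : {linear F -> X},
          [/\ is_bounded T,
              forall x, T (delta x) = f x,
              op_norm T = lip_const f &
              forall S : {linear F -> X},
                is_bounded S -> (forall x, S (delta x) = f x) ->
                forall v, S v = T v]].

Definition series_cvg (R : realType) (p : R) (X : pNormedType p)
    (u : nat -> X) (x : X) : Prop :=
  pnorm_cvg (fun n => \sum_(0 <= i < n) u i) x.

(* Bases are indexed by nat: this is the notion for infinite-dimensional
   spaces. *)
Definition is_schauder_basis (R : realType) (p : R) (X : pNormedType p)
    (e : nat -> X) : Prop :=
  forall x, exists! a : nat -> R, series_cvg (fun i => a i *: e i) x.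

Definition unconditionally_cvg (R : realType) (p : R) (X : pNormedType p)
    (u : nat -> X) : Prop :=
  forall s : nat -> nat, bijective s ->
    exists l, series_cvg (fun i => u (s i)) l.

Definition is_unconditional_basis (R : realType) (p : R) (X : pNormedType p)
    (e : nat -> X) : Prop :=
  is_schauder_basis e /\
  forall (x : X) (a : nat -> R), series_cvg (fun i => a i *: e i) x ->
    unconditionally_cvg (fun i => a i *: e i).

Section UnitInterval.
Variables (R : realType) (p : R).
Hypotheses (p_gt0 : 0 < p) (p_le1 : p <= 1).

Lemma powR_subadd (a b : R) : 0 <= a -> 0 <= b ->
  (a + b) `^ p <= a `^ p + b `^ p.
Proof.
move=> a0 b0; have := addr_ge0 a0 b0; rewrite le_eqVlt => /predU1P[<-|s0].
  by rewrite powR0 ?gt_eqF// addr_ge0 ?powR_ge0.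
have le_pow (t : R) : 0 <= t -> t <= 1 -> t <= t `^ p.
  rewrite le_eqVlt => /predU1P[<- _|t0 t1]; first exact: powR_ge0.
  by rewrite -{1}(powRr1 (ltW t0)) ger_powR// t0.
have scale (t : R) : 0 <= t -> t <= a + b ->
    t / (a + b) * (a + b) `^ p <= t `^ p.
  move=> t0 ts; have q0 : 0 <= t / (a + b) by rewrite divr_ge0// ltW.
  rewrite -{2}(divfK (lt0r_neq0 s0) t) powRM ?(ltW s0)//.
  by apply: ler_wpM2r; rewrite ?powR_ge0// le_pow// ler_pdivrMr// mul1r.
have := lerD (scale a a0 _) (scale b b0 _).
by rewrite -mulrDl -mulrDl divff ?gt_eqF// mul1r lerDl lerDr => ->.
Qed.

Let I := {x : R | x \in `[0, 1]}.
Let d (x y : I) : R := `|val x - val y|.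

Let d_ge0 x y : 0 <= d x y. Proof. exact: normr_ge0. Qed.

Let d_eq0 x y : d x y = 0 <-> x = y.
Proof.
split=> [/eqP|->]; last by rewrite /d subrr normr0.
by rewrite normr_eq0 subr_eq0 => /eqP/val_inj.
Qed.

Let d_sym x y : d x y = d y x. Proof. exact: distrC. Qed.

Let d_triangle x y z : d x y `^ p <= d x z `^ p + d z y `^ p.
Proof.
apply: le_trans (powR_subadd (d_ge0 _ _) (d_ge0 _ _)).
rewrite ge0_ler_powR ?nnegrE ?addr_ge0 ?d_ge0 ?(ltW p_gt0)//.
exact: ler_distD.
Qed.

Let zero_in : 0 \in `[0, 1 : R].
Proof. by rewrite in_itv/= lexx ler01. Qed.

Definition unit_interval : pMetricSpace p :=
  @PMetricSpace R p {x : R | x \in `[0, 1]}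
    (fun x y => `|val x - val y|) (exist _ 0 zero_in)
    d_ge0 d_eq0 d_sym d_triangle.

End UnitInterval.

(* Main.v *)
Require Import Defs.
From HB Require Import structures.
From mathcomp Require Import all_boot all_order all_algebra.
From mathcomp Require Import all_classical all_reals all_analysis.
From mathcomp Require Import ring lra zify.
Import Order.TTheory GRing.Theory Num.Theory.
Import numFieldNormedType.Exports.
Set Implicit Arguments.
Unset Strict Implicit.
Unset Printing Implicit Defensive.
Local Open Scope ring_scope.

(** Two facts are proved about the free space F, generated by the curve of the
    points delta(x), 0 <= x <= 1, which is isometric to [0, 1].

    Schauder basis. For a finite set S of nodes containing 0 and 1, let P send
    delta(x) to the point of the chord between delta(a) and delta(b), where a
    and b are the nodes surrounding x. Two points x < y are joined through the
    node after x and the node before y, so that this map is Lipschitz with the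
    constant 3^(1/p), whatever S is ([lipschitz_of_cells]), and it extends to a
    projection of F ([interpolation]). Adding the dyadic numbers to S one by one
    gives commuting projections, uniformly bounded, of ranks increasing by one,
    which converge to the identity on the curve, hence everywhere: they are the
    partial sums of a basis, whose coordinate functionals are the hat functions
    of Faber and Schauder ([faber_schauder_basis]).

    No unconditional basis. The dual of F is the space of the Lipschitz functions
    vanishing at 0, that is L^infinity, so F is seen by its functionals as L^1
    ([molecule] sends a step function to F), and the argument is a gliding hump
    in L^1.
    In an unconditional basis the projections onto finite sets of coordinates
    are bounded by one constant K; this needs the open mapping argument, hence
    Baire's theorem ([unconditional_basis_projections]). On the other hand a step
    function times the k-th Rademacher function tends weakly to 0
    ([rademacher_weakly_null]). Start from h = 1 and replace h by h (1 + r) again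
    and again, with r a Rademacher function of very high frequency: h stays
    nonnegative of mean 1, the increments f = h r are nearly supported by
    disjoint blocks of coordinates, and keeping the blocks of every other
    increment is a projection. The sum s of these increments then is nearly
    P h, of L^1 norm at most K; but h is concentrated on smaller and smaller
    sets, and every increment kept adds at least 1/3 to a lower bound of the L^1
    norm of s, which is a contradiction ([gliding_states],
    [bounded_projections_absurd]).

    Since pnorm is not subadditive, estimates are made with its p-th power
    [fnorm], which is subadditive, or, when only functionals matter, with
    [weak_le]. *)

(** * Calculus of p-norms *)

Lemma real_cauchy_cvg (R : realType) (u : nat -> R) :
  (forall e : R, 0 < e -> exists N, forall m n,
     (N <= m)%N -> (N <= n)%N -> `|u m - u n| < e) ->
  exists l, forall e, 0 < e -> exists N, forall n, (N <= n)%N -> `|u n - l| < e.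
Proof.
move=> uC.
have /cvg_ex[l ul] : cvgn u.
  apply: R_complete; apply: cauchy_exP => e e0.
  have [N NP] := uC e e0.
  exists (u N); exists N => // n /= Nn; rewrite /ball/=.
  exact: NP.
exists l => e e0; move/cvgrPdist_lt : ul => /(_ e e0)[N _ NP].
by exists N => n Nn; rewrite distrC; exact: NP.
Qed.

Section FNorm.
Variables (R : realType) (p : R).
Hypothesis p_gt0 : 0 < p.

(** The p-th power of a p-norm is subadditive and invariant under change of sign:
    it makes X an additive metric group, at the price of the homogeneity. *)
Definition fnorm (X : pNormedType p) (x : X) : R := pnorm x `^ p.

Lemma ltr_powp (a b : R) : 0 <= a -> 0 <= b -> (a `^ p < b `^ p) = (a < b).
Proof.
move=> a0 b0; apply/idP/idP; last by move=> ?; apply: gt0_ltr_powR.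
rewrite !ltNge; apply: contra => ba.
by apply: ge0_ler_powR => //; rewrite ltW.
Qed.

Lemma ler_powp (a b : R) : 0 <= a -> 0 <= b -> (a `^ p <= b `^ p) = (a <= b).
Proof. by move=> a0 b0; rewrite !leNgt ltr_powp. Qed.

Lemma powpVK (a : R) : 0 <= a -> (a `^ p^-1) `^ p = a.
Proof. by move=> a0; rewrite -powRrM mulVf ?powRr1// gt_eqF. Qed.

Section OneSpace.
Variable X : pNormedType p.
Implicit Types x y : X.

Lemma pnorm0 : pnorm (0 : X) = 0.
Proof. by rewrite -(scale0r (0 : X)) pnormZ normr0 mul0r. Qed.

Lemma pnormN x : pnorm (- x) = pnorm x.
Proof. by rewrite -scaleN1r pnormZ normrN1 mul1r. Qed.

Lemma pnorm_gt0 x : x <> 0 -> 0 < pnorm x.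
Proof.
move=> x0; rewrite lt_neqAle pnorm_ge0 andbT eq_sym.
by apply/eqP => /pnorm_eq0.
Qed.

Lemma fnorm_ge0 x : 0 <= fnorm x. Proof. exact: powR_ge0. Qed.

Lemma fnorm0 : fnorm (0 : X) = 0.
Proof. by rewrite /fnorm pnorm0 powR0// gt_eqF. Qed.

Lemma fnorm_gt0 x : x <> 0 -> 0 < fnorm x.
Proof. by move=> /pnorm_gt0; exact: powR_gt0. Qed.

Lemma fnorm_small_eq0 x : (forall e, 0 < e -> fnorm x < e) -> x = 0.
Proof.
move=> xe; apply/eqP/negP => /negP/eqP/fnorm_gt0 x0.
by have := xe _ x0; rewrite ltxx.
Qed.

Lemma fnormN x : fnorm (- x) = fnorm x. Proof. by rewrite /fnorm pnormN. Qed.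

Lemma fnormD x y : fnorm (x + y) <= fnorm x + fnorm y.
Proof. exact: pnorm_triangle. Qed.

Lemma fnormB x y : fnorm (x - y) <= fnorm x + fnorm y.
Proof. by rewrite -[fnorm y]fnormN; exact: fnormD. Qed.

Lemma fnormC x y : fnorm (x - y) = fnorm (y - x).
Proof. by rewrite -fnormN opprB. Qed.

Lemma fnorm_dist z x y : fnorm (x - y) <= fnorm (x - z) + fnorm (z - y).
Proof. by apply: le_trans (fnormD _ _); rewrite addrA subrK. Qed.

Lemma fnormZ (a : R) x : fnorm (a *: x) = `|a| `^ p * fnorm x.
Proof. by rewrite /fnorm pnormZ powRM ?pnorm_ge0. Qed.

Lemma fnorm_sum (I : Type) (s : seq I) (P : pred I) (f : I -> X) :
  fnorm (\sum_(i <- s | P i) f i) <= \sum_(i <- s | P i) fnorm (f i).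
Proof.
elim/big_ind2 : _ => [|x a y b xa yb|//]; first by rewrite fnorm0.
exact: le_trans (fnormD _ _) (lerD xa yb).
Qed.

Definition fcvg (u : nat -> X) (l : X) : Prop :=
  forall e, 0 < e -> exists N, forall n, (N <= n)%N -> fnorm (u n - l) < e.

Lemma pnorm_cvgP (u : nat -> X) (l : X) : pnorm_cvg u l <-> fcvg u l.
Proof.
rewrite /pnorm_cvg; split=> [/cvgrPdist_lt ul e e0|ul].
  have [N _ NP] := ul _ (powR_gt0 p^-1 e0).
  exists N => n /NP /=; rewrite sub0r normrN ger0_norm ?pnorm_ge0// => une.
  by rewrite /fnorm -(powpVK (ltW e0)) ltr_powp ?pnorm_ge0 ?powR_ge0.
apply/cvgrPdist_lt => e e0.
have [N NP] := ul _ (powR_gt0 p e0).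
exists N => // n /= Nn; rewrite sub0r normrN ger0_norm ?pnorm_ge0//.
by rewrite -ltr_powp ?pnorm_ge0 ?(ltW e0)//; exact: NP.
Qed.

Lemma fcvg_unique (u : nat -> X) (l m : X) : fcvg u l -> fcvg u m -> l = m.
Proof.
move=> ul um; apply/eqP; rewrite -subr_eq0; apply/eqP/fnorm_small_eq0 => e e0.
have e2 : 0 < e / 2 by lra.
have [N NP] := ul _ e2; have [M MP] := um _ e2.
have := NP _ (leq_maxl N M); have := MP _ (leq_maxr N M).
by have := fnorm_dist (u (maxn N M)) l m; rewrite (fnormC l (u _)); lra.
Qed.

Lemma fcvgD (u v : nat -> X) (l m : X) :
  fcvg u l -> fcvg v m -> fcvg (fun n => u n + v n) (l + m).
Proof.
move=> ul um e e0; have e2 : 0 < e / 2 by lra.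
have [N NP] := ul _ e2; have [M MP] := um _ e2.
exists (maxn N M) => n; rewrite geq_max => /andP[/NP Nn /MP Mn].
by have := fnormD (u n - l) (v n - m); rewrite opprD addrACA; lra.
Qed.

Lemma fcvgZ (a : R) (u : nat -> X) (l : X) :
  fcvg u l -> fcvg (fun n => a *: u n) (a *: l).
Proof.
move=> ul e e0; set c := `|a| `^ p + 1.
have c0 : 0 < c by have := powR_ge0 `|a| p; rewrite /c; lra.
have [N NP] := ul _ (divr_gt0 e0 c0).
exists N => n /NP; rewrite ltr_pdivlMr// -scalerBr fnormZ => ule.
apply: le_lt_trans ule; rewrite mulrC ler_wpM2l ?fnorm_ge0// /c; lra.
Qed.

Lemma fcvg_cst (l : X) : fcvg (fun=> l) l.
Proof. by move=> e e0; exists 0%N => n _; rewrite subrr fnorm0. Qed.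

Lemma fcvg_scale (a : nat -> R) (l : R) (x : X) :
  (forall e, 0 < e -> exists N, forall n, (N <= n)%N -> `|a n - l| < e) ->
  fcvg (fun n => a n *: x) (l *: x).
Proof.
move=> al; have [->|/eqP/fnorm_gt0 x0] := eqVneq x 0.
  by rewrite scaler0 => e e0; exists 0%N => n _; rewrite scaler0 subrr fnorm0.
move=> e e0; have ex0 : 0 < e / fnorm x by exact: divr_gt0.
have [N NP] := al _ (powR_gt0 p^-1 ex0).
exists N => n /NP ale; rewrite -scalerBl fnormZ -ltr_pdivlMr//.
by rewrite -(powpVK (ltW ex0)) ltr_powp ?powR_ge0.
Qed.

Lemma fcvg_sum (I : Type) (s : seq I) (P : pred I) (u : I -> nat -> X) (l : I -> X) :
  (forall i, P i -> fcvg (u i) (l i)) ->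
  fcvg (fun n => \sum_(i <- s | P i) u i n) (\sum_(i <- s | P i) l i).
Proof.
move=> ul; elim: s => [|i s IH].
  by rewrite big_nil; under eq_fun do rewrite big_nil; exact: fcvg_cst.
rewrite big_cons; under eq_fun do rewrite big_cons.
by case: ifPn => // Pi; apply: fcvgD => //; exact: ul.
Qed.

Lemma fcvg_fnorm_le (u : nat -> X) (l : X) (C : R) : fcvg u l ->
  (exists N, forall n, (N <= n)%N -> fnorm (u n) <= C) -> fnorm l <= C.
Proof.
move=> ul [N uC]; apply/ler_addgt0Pr => e e0.
have [M MP] := ul _ e0.
have := fnormB (u (maxn N M)) (u (maxn N M) - l).
rewrite subKr; have := MP _ (leq_maxr N M); have := uC _ (leq_maxl N M); lra.
Qed.

Lemma fcvg_cauchy (u : nat -> X) (l : X) : fcvg u l ->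
  forall e, 0 < e -> exists N, forall m n,
    (N <= m)%N -> (N <= n)%N -> fnorm (u m - u n) < e.
Proof.
move=> ul e e0; have e2 : 0 < e / 2 by lra.
have [N NP] := ul _ e2.
exists N => m n /NP Nm /NP; have := fnorm_dist l (u m) (u n).
by rewrite (fnormC l); lra.
Qed.

End OneSpace.

Lemma fnorm_complete (X : pBanachType p) (u : nat -> X) :
  (forall e, 0 < e -> exists N, forall m n,
     (N <= m)%N -> (N <= n)%N -> fnorm (u m - u n) < e) ->
  exists l, fcvg u l.
Proof.
move=> uC; have [|l ul] := @pnorm_complete R p X u.
  move=> e e0; have [N NP] := uC _ (powR_gt0 p e0).
  exists N => m n Nm Nn.
  by rewrite -ltr_powp ?pnorm_ge0 ?(ltW e0)//; exact: NP.
by exists l; exact/pnorm_cvgP.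
Qed.

Lemma bounded_fnorm (X Y : pNormedType p) (T : X -> Y) (C : R) : 0 <= C ->
  (forall x, pnorm (T x) <= C * pnorm x) ->
  forall x, fnorm (T x) <= C `^ p * fnorm x.
Proof.
move=> C0 TC x; rewrite /fnorm -powRM ?pnorm_ge0// ler_powp ?pnorm_ge0//.
by rewrite mulr_ge0 ?pnorm_ge0.
Qed.

Lemma bounded_fcvg (X Y : pNormedType p) (T : {linear X -> Y}) (C : R) :
  (forall x, fnorm (T x) <= C * fnorm x) ->
  forall (u : nat -> X) l, fcvg u l -> fcvg (fun n => T (u n)) (T l).
Proof.
move=> TC u l ul e e0; set c := `|C| + 1.
have c0 : 0 < c by rewrite /c; have := normr_ge0 C; lra.
have [N NP] := ul _ (divr_gt0 e0 c0).
exists N => n /NP; rewrite ltr_pdivlMr// -linearB => ule.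
apply: le_lt_trans (TC _) _; apply: le_lt_trans ule.
by rewrite mulrC ler_wpM2l ?fnorm_ge0// /c; have := ler_norm C; lra.
Qed.

End FNorm.

(** * The real line and closed subspaces as p-Banach spaces *)

Section RealLine.
Variables (R : realType) (p : R).
Hypotheses (p_gt0 : 0 < p) (p_le1 : p <= 1).

(** The triangle inequality of the canonical p-Banach structure holds for 0 < p <= 1
    only: these bounds are arguments of the type, so that the structure can be
    inferred from it. *)
Definition real_line of 0 < p & p <= 1 : Type := R^o.
Local Notation L := (real_line p_gt0 p_le1).
HB.instance Definition _ := GRing.Lmodule.on L.

Let abs (x : L) : R := `|(x : R)|.

Let abs_ge0 (x : L) : 0 <= abs x. Proof. exact: normr_ge0. Qed.

Let abs_eq0 (x : L) : abs x = 0 -> x = 0. Proof. exact: normr0_eq0. Qed.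

Let absZ (a : R) (x : L) : abs (a *: x) = `|a| * abs x.
Proof. exact: normrM. Qed.

Let abs_triangle (x y : L) : abs (x + y) `^ p <= abs x `^ p + abs y `^ p.
Proof.
apply: le_trans (powR_subadd p_gt0 p_le1 (abs_ge0 _) (abs_ge0 _)).
by rewrite ler_powp ?addr_ge0 ?abs_ge0//; exact: ler_normD.
Qed.

HB.instance Definition _ :=
  Lmodule_isPNormed.Build R p L abs_ge0 abs_eq0 absZ abs_triangle.

Let abs_complete (u : nat -> L) :
  pnorm_cauchy u -> exists l, pnorm_cvg u l.
Proof.
move=> uC; have [l ul] := real_cauchy_cvg uC.
exists (l : L); apply/cvgrPdist_lt => e e0.
have [N NP] := ul e e0; exists N => // n /NP.
by rewrite sub0r normrN normr_id.
Qed.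

HB.instance Definition _ := PNormed_isComplete.Build R p L abs_complete.

Lemma pnorm_real_line (x : L) : pnorm x = `|x : R|. Proof. by []. Qed.

End RealLine.

Section ClosedSubspace.
Variables (R : realType) (p : R) (F : pBanachType p) (S : F -> Prop).

Definition closed_under_combinations : Prop :=
  forall a u v, S u -> S v -> S (a *: u + v).
Definition closed_under_limits : Prop :=
  forall u l, (forall n : nat, S (u n)) -> fcvg u l -> S l.

Hypotheses (p_gt0 : 0 < p) (S0 : S 0).
Hypotheses (SZD : closed_under_combinations) (Scl : closed_under_limits).

Let Spred : {pred F} := fun v => `[< S v >].

Let Spred_submod : submod_closed Spred.
Proof.
split; first exact/asboolP.
by move=> a u v /asboolP Su /asboolP Sv; apply/asboolP; exact: SZD.
Qed.

HB.instance Definition _ := GRing.isSubmodClosed.Build R F Spred Spred_submod.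

(** The closure properties are arguments of the type, so that its canonical
    structures can be inferred from it. *)
Definition closed_subspace
  of 0 < p & S 0 & closed_under_combinations & closed_under_limits : Type :=
  {v : F | v \in Spred}.
Local Notation Y := (closed_subspace p_gt0 S0 SZD Scl).
HB.instance Definition _ := [isSub of Y for @sval _ _].
HB.instance Definition _ := [Choice of Y by <:].
HB.instance Definition _ := [SubChoice_isSubLmodule of Y by <:].

Let ynorm (y : Y) : R := pnorm (val y).

Let ynorm_eq0 (y : Y) : ynorm y = 0 -> y = 0.
Proof. by move/pnorm_eq0 => y0; apply: val_inj; rewrite y0 raddf0. Qed.

Let ynormZ (a : R) (y : Y) : ynorm (a *: y) = `|a| * ynorm y.
Proof. by rewrite /ynorm linearZ /= pnormZ. Qed.

Let ynorm_triangle (x y : Y) : ynorm (x + y) `^ p <= ynorm x `^ p + ynorm y `^ p.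
Proof. by rewrite /ynorm raddfD; exact: pnorm_triangle. Qed.

HB.instance Definition _ := Lmodule_isPNormed.Build R p Y
  (fun y => pnorm_ge0 (val y)) ynorm_eq0 ynormZ ynorm_triangle.

Let ynormB (x y : Y) : pnorm (x - y) = pnorm (val x - val y).
Proof. by rewrite -raddfB. Qed.

Let y_complete (u : nat -> Y) : pnorm_cauchy u -> exists l, pnorm_cvg u l.
Proof.
move=> uC; have [|l ul] := @pnorm_complete R p F (val \o u).
  move=> e /uC[N NP]; exists N => m n Nm Nn.
  by have := NP _ _ Nm Nn; rewrite ynormB.
have Sl : l \in Spred.
  apply/asboolP/(@Scl (val \o u)); last exact/pnorm_cvgP.
  by move=> n; apply/asboolP; exact: valP (u n).
exists (exist _ l Sl : Y); rewrite /pnorm_cvg.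
by under eq_fun do rewrite ynormB.
Qed.

HB.instance Definition _ := PNormed_isComplete.Build R p Y y_complete.

Definition closed_subspace_incl (y : Y) : F := val y.
HB.instance Definition _ := GRing.Linear.copy closed_subspace_incl (val : Y -> F).

Lemma pnorm_closed_subspace (y : Y) : pnorm y = pnorm (val y). Proof. by []. Qed.

Lemma mem_closed_subspace v : S v -> v \in Spred. Proof. by move=> ?; apply/asboolP. Qed.

Lemma closed_subspace_mem (y : Y) : S (val y).
Proof. by apply/asboolP; exact: valP y. Qed.

End ClosedSubspace.

(** * Extension and density in free spaces *)

Section FreeSpace.
Variables (R : realType) (p : R).
Hypothesis p_gt0 : 0 < p.

(** The supremum defining [op_norm] is over the unit ball: rescale x to norm 1. *)
Lemma le_op_norm (X Y : pNormedType p) (T : {linear X -> Y}) :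
  is_bounded T -> forall x, pnorm (T x) <= op_norm T * pnorm x.
Proof.
move=> [C TC] x; have [->|/eqP x0] := eqVneq x 0.
  by rewrite linear0 !pnorm0 mulr0.
have n0 := pnorm_gt0 x0.
rewrite -ler_pdivrMr//; apply: ub_le_sup; last first.
  exists ((pnorm x)^-1 *: x) => /=.
    by rewrite pnormZ ger0_norm ?invr_ge0 ?pnorm_ge0// mulVf ?gt_eqF.
  by rewrite linearZ pnormZ ger0_norm ?invr_ge0 ?pnorm_ge0// mulrC.
exists `|C| => _ [y /= y1 <-]; apply: le_trans (TC y) _.
apply: (@le_trans _ _ (`|C| * pnorm y)).
  by rewrite ler_wpM2r ?pnorm_ge0 ?ler_norm.
by rewrite ler_piMr.
Qed.

Variables (M : pMetricSpace p) (F : pBanachType p) (delta : M -> F).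
Hypothesis hF : is_lipschitz_free delta.

Lemma lip_const_le (X : pNormedType p) (f : M -> X) (L : R) : 0 <= L ->
  (forall x y, pnorm (f x - f y) <= L * pdist x y) -> lip_const f <= L.
Proof.
move=> L0 fL; rewrite /lip_const; set E := (E in sup E).
have [->|/set0P E0] := eqVneq E set0; first by rewrite sup0.
apply: ge_sup => // _ [x [y [xy ->]]].
rewrite ler_pdivrMr// lt_neqAle pdist_ge0 andbT eq_sym.
by apply/eqP => /pdist_eq0.
Qed.

(** The form in which the universal property is used: a bound on the Lipschitz
    constant of f is a bound on the norm of its extension. *)
Lemma free_extension (X : pBanachType p) (f : M -> X) (L : R) : 0 <= L ->
  (forall x y, pnorm (f x - f y) <= L * pdist x y) -> f (base_point M) = 0 ->
  exists T : {linear F -> X},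
    (forall x, T (delta x) = f x) /\ forall v, pnorm (T v) <= L * pnorm v.
Proof.
move=> L0 fL f0; have [_ _ /(_ X f)] := hF.
case=> [||T [bT Td Tn _]] //; first by exists L.
exists T; split=> // v; apply: le_trans (le_op_norm bT v) _.
by rewrite Tn ler_wpM2r ?pnorm_ge0// lip_const_le.
Qed.

(** A closed subspace S containing the image of delta is everything. Extend delta,
    seen as a map into the p-Banach space S, to a map T from F to S; composed
    with the inclusion, T and the identity are two extensions of delta to F, hence
    they are equal. This is how the density of the span of delta is used. *)
Lemma free_closed_subspaceT (S : F -> Prop) : S 0 ->
  closed_under_combinations S -> closed_under_limits S ->
  (forall x, S (delta x)) -> forall v, S v.
Proof.
move=> S0 SZD Scl Sd v.
pose Y : pBanachType p := closed_subspace p_gt0 S0 SZD Scl.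
pose f (x : M) : Y := exist _ (delta x) (@mem_closed_subspace R p F S _ (Sd x)).
have [dist_d d0 ext] := hF.
have normf x y : pnorm (f x - f y) = pdist x y.
  rewrite -dist_d pnorm_closed_subspace.
  by rewrite -[val _]/(closed_subspace_incl (f x - f y)) linearB.
have [||T [Td Tn]] := @free_extension Y f 1 ler01.
- by move=> x y; rewrite mul1r normf.
- exact/val_inj.
pose iT : {linear F -> F} := @closed_subspace_incl R p F S p_gt0 S0 SZD Scl \o T.
have [||U [_ _ _ Uuniq]] := ext F delta.
- by exists 1 => x y; rewrite mul1r dist_d.
- by [].
have idU := Uuniq (idfun : {linear F -> F}).
have iTU := Uuniq iT.
have -> : v = iT v.
  rewrite iTU.
  - by rewrite -idU//; exists 1 => w; rewrite mul1r.
  - by exists 1 => w; exact: Tn.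
  - by move=> x; rewrite /iT /= Td.
exact: (@closed_subspace_mem R p F S p_gt0 S0 SZD Scl (T v)).
Qed.

End FreeSpace.

(** * Unconditionally convergent series *)

Section UnconditionalSums.
Variables (R : realType) (p : R).
Hypothesis p_gt0 : 0 < p.
Variable X : pNormedType p.

(** The permutation of nat that, in each block [n k, n k.+1[, enumerates first the
    indices in B k, in increasing order, and then the others. It is defined by
    the words that list its first n k values. *)
Section BlockPermutation.
Variables (B : nat -> pred nat) (n : nat -> nat).
Hypotheses (n0 : n 0 = 0%N) (n_lt : forall k, (n k < n k.+1)%N).

Let block k := index_iota (n k) (n k.+1).
Let front k := [seq i <- block k | B k i].

Let word := fix word k := if k is l.+1
  then word l ++ front l ++ [seq i <- block l | ~~ B l i] else [::].

Let n_ge k : (k <= n k)%N.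
Proof. by elim: k => // k IH; exact: leq_ltn_trans IH (n_lt k). Qed.

Let n_mono k l : (k <= l)%N -> (n k <= n l)%N.
Proof.
move=> /subnK <-; elim: (l - k)%N => // m IH.
by rewrite addSn; exact: leq_trans IH (ltnW (n_lt _)).
Qed.

Let word_perm k : perm_eq (word k) (index_iota 0 (n k)).
Proof.
elim: k => [|k IH]; first by rewrite n0.
have -> : index_iota 0 (n k.+1) = index_iota 0 (n k) ++ block k.
  by rewrite /block /index_iota !subn0 -{3}[n k]add0n -iotaD subnKC// ltnW.
by apply: perm_cat => //; rewrite perm_filterC.
Qed.

Let word_size k : size (word k) = n k.
Proof. by rewrite (perm_size (word_perm k)) size_iota subn0. Qed.

Let word_uniq k : uniq (word k).
Proof. by rewrite (perm_uniq (word_perm k)) iota_uniq. Qed.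

Let mem_word k m : (m \in word k) = (m < n k)%N.
Proof. by rewrite (perm_mem (word_perm k)) mem_index_iota. Qed.

Let nth_word_le k l i : (k <= l)%N -> (i < n k)%N ->
  nth 0%N (word l) i = nth 0%N (word k) i.
Proof.
move=> /subnK <-; elim: (l - k)%N => // m IH ik.
rewrite addSn /= nth_cat word_size (leq_trans ik) ?IH//.
by apply: n_mono; rewrite leq_addl.
Qed.

Definition block_perm i := nth 0%N (word i.+1) i.

Let block_permE k i : (i < n k)%N -> block_perm i = nth 0%N (word k) i.
Proof.
move=> ik; rewrite /block_perm.
have ii : (i < n i.+1)%N := n_ge i.+1.
by case: (leqP k i.+1) => [|/ltnW] kl; rewrite (nth_word_le kl).
Qed.

Lemma block_perm_bij : bijective block_perm.
Proof.
have inj : injective block_perm.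
  move=> i j; set k := (maxn i j).+1.
  have ik : (i < n k)%N by apply: leq_trans (n_ge k); rewrite ltnS leq_maxl.
  have jk : (j < n k)%N by apply: leq_trans (n_ge k); rewrite ltnS leq_maxr.
  rewrite !(@block_permE k)// => /eqP.
  by rewrite nth_uniq ?word_size// => /eqP.
have surj : cancel (fun m => index m (word m.+1)) block_perm.
  move=> m; have mm : m \in word m.+1 by rewrite mem_word; exact: n_ge m.+1.
  by rewrite (@block_permE m.+1) ?nth_index// -word_size index_mem.
by exists (fun m => index m (word m.+1)) => // i; apply: inj; exact: surj.
Qed.

Let sum_word (u : nat -> X) k m : (m <= n k)%N ->
  \sum_(0 <= i < m) u (block_perm i) = \sum_(x <- take m (word k)) u x.
Proof.
move=> mk; have -> : take m (word k) = map block_perm (index_iota 0 m).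
  have szk : size (take m (word k)) = m by rewrite size_takel ?word_size.
  apply: (@eq_from_nth _ 0%N); first by rewrite szk size_map size_iota subn0.
  move=> i; rewrite szk => im.
  rewrite nth_take// (nth_map 0%N) ?size_iota ?subn0// nth_iota ?subn0//.
  by rewrite add0n (@block_permE k)//; exact: leq_trans im mk.
by rewrite big_map.
Qed.

(** So the sum of u over the part B k of a block is a difference of two partial
    sums of the rearranged series. *)
Lemma block_perm_sum (u : nat -> X) k : exists2 m, (n k <= m)%N &
  \sum_(0 <= i < m) u (block_perm i) - \sum_(0 <= i < n k) u (block_perm i) =
  \sum_(n k <= i < n k.+1 | B k i) u i.
Proof.
have fk : (n k + size (front k) <= n k.+1)%N.
  have := word_size k.+1; rewrite /= !size_cat word_size => <-.
  by rewrite addnA leq_addr.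
exists (n k + size (front k))%N; first exact: leq_addr.
rewrite (@sum_word _ k.+1)// (@sum_word _ k)// -word_size take_size /=.
rewrite catA take_size_cat ?size_cat// big_cat/=.
by rewrite [X in X - _]addrC addrK big_filter word_size.
Qed.

End BlockPermutation.

(** Otherwise there would be, beyond every N, a finite set of indices over which
    the sum of u is not small. Listing these sets one after the other, each at
    the start of a block, gives a rearrangement whose partial sums are not Cauchy. *)
Lemma unconditional_tail (u : nat -> X) : unconditionally_cvg u ->
  forall eps, 0 < eps -> exists N,
    forall (B : pred nat) M, fnorm (\sum_(N <= i < M | B i) u i) <= eps.
Proof.
move=> uu eps eps0; apply: contrapT => noN.
have /choice[f fP] : forall N, exists BM : pred nat * nat,
    eps < fnorm (\sum_(N <= i < BM.2 | BM.1 i) u i).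
  move=> N; apply: contrapT => noBM; apply: noN; exists N => B M.
  by rewrite leNgt; apply/negP => lt1; apply: noBM; exists (B, M).
have f_lt N : (N < (f N).2)%N.
  rewrite ltnNge; apply/negP => le; have := fP N.
  by rewrite big_geq// fnorm0// ltNge ltW.
pose n k := iter k (fun N => (f N).2) 0%N.
have n_lt k : (n k < n k.+1)%N by rewrite /n /=; exact: f_lt.
have n_ge k : (k <= n k)%N by elim: k => // k IH; exact: leq_ltn_trans IH _.
pose B k := (f (n k)).1.
have [l] := uu _ (block_perm_bij B (erefl : n 0%N = 0%N) n_lt).
move=> /(pnorm_cvgP p_gt0)/fcvg_cauchy/(_ eps eps0)[N NP].
have [m nm msum] := block_perm_sum B (erefl : n 0%N = 0%N) n_lt u N.
have := NP m (n N) (leq_trans (n_ge N) nm) (n_ge N).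
by rewrite msum ltNge (ltW (fP _)).
Qed.

Lemma unconditional_bounded (u : nat -> X) : unconditionally_cvg u ->
  exists C, forall (B : pred nat) N,
    fnorm (\sum_(0 <= i < N | B i) u i) <= C.
Proof.
move=> /unconditional_tail/(_ 1 ltr01)[N NP].
have head (B : pred nat) M : (M <= N)%N ->
    fnorm (\sum_(0 <= i < M | B i) u i) <= \sum_(0 <= i < N) fnorm (u i).
  move=> MN; apply: le_trans (fnorm_sum p_gt0 _ _ _) _.
  rewrite big_mkcond (big_cat_nat (leq0n M) MN)/=.
  rewrite -[leLHS]addr0 lerD ?sumr_ge0//; last by move=> *; exact: fnorm_ge0.
  by apply: ler_sum => i _; case: ifP => // _; exact: fnorm_ge0.
exists (\sum_(0 <= i < N) fnorm (u i) + 1) => B M.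
have [MN|/ltnW NM] := leqP M N.
  by have := head B M MN; lra.
rewrite (big_cat_nat (leq0n N) NM)/=.
apply: le_trans (fnormD _ _) _; apply: lerD (NP B M).
exact: head (leqnn N).
Qed.

End UnconditionalSums.

(** * Bounded projections of an unconditional basis *)

Lemma half_pow_small (R : realType) (C e : R) : 0 < e ->
  exists N, forall n, (N <= n)%N -> C / 2 ^+ n < e.
Proof.
move=> e0; have [C0|C0] := leP C 0.
  exists 0%N => n _; apply: le_lt_trans e0.
  by rewrite pmulr_lle0// invr_gt0 exprn_gt0.
exists (Num.bound (C / e)) => n Nn.
rewrite ltr_pdivrMr ?exprn_gt0// mulrC -ltr_pdivrMr//.
apply: lt_le_trans (archi_boundP (ltW (divr_gt0 C0 e0))) _.
by rewrite -natrX ler_nat (leq_trans Nn)// ltnW// ltn_expl.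
Qed.

Section Baire.
Variables (R : realType) (p : R).
Hypothesis p_gt0 : 0 < p.
Variable X : pBanachType p.

(** Baire's theorem: if no E n were dense in a ball, then one could shrink balls so
    that the n-th one avoids E n, and their common point would be in no E n. *)
Lemma baire_somewhere_dense (E : nat -> X -> Prop) : (forall x, exists n, E n x) ->
  exists n x0 r, 0 < r /\ forall y, fnorm (y - x0) < r ->
    forall eta, 0 < eta -> exists2 z, E n z & fnorm (y - z) < eta.
Proof.
move=> cover; apply: contrapT => nodense.
have /choice[g gP] : forall t : nat * (X * R), exists t' : X * R, 0 < t.2.2 ->
    [/\ 0 < t'.2, t'.2 <= t.2.2 / 2, fnorm (t'.1 - t.2.1) + t'.2 <= t.2.2 &
      forall z, E t.1 z -> t'.2 < fnorm (t'.1 - z)].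
  move=> [n [x r]] /=; have [r0|] := boolP (0 < r); last by exists (x, r).
  have [y yr [eta eta0 yeta]] : exists2 y, fnorm (y - x) < r &
      exists2 eta, 0 < eta & forall z, E n z -> eta <= fnorm (y - z).
    apply: contrapT => no; apply: nodense; exists n, x, r; split=> // y yr eta eta0.
    apply: contrapT => noz; apply: no; exists y => //; exists eta => // z Ez.
    by rewrite leNgt; apply/negP => zeta; apply: noz; exists z.
  exists (y, Num.min (eta / 2) ((r - fnorm (y - x)) / 2)) => _ /=.
  have yx0 := fnorm_ge0 (y - x).
  split.
  - by rewrite lt_min; lra.
  - by rewrite ge_min; apply/orP; right; lra.
  - have : Num.min (eta / 2) ((r - fnorm (y - x)) / 2) <= (r - fnorm (y - x)) / 2.
      by rewrite ge_min lexx orbT.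
    lra.
  - move=> z /yeta; have : Num.min (eta / 2) ((r - fnorm (y - x)) / 2) <= eta / 2.
      by rewrite ge_min lexx.
    lra.
(* t n = (centre, radius) of the n-th ball, disjoint from E i for i < n *)
pose t := fix t n := if n is m.+1 then g (m, t m) else (0 : X, 1 : R).
have t0 n : 0 < (t n).2 by elim: n => // n IH; have [] := gP (n, t n) IH.
have tS n := gP (n, t n) (t0 n).
have t2 n : (t n).2 <= 1 / 2 ^+ n.
  elim: n => [|n IH]; first by rewrite expr0 divr1.
  have [_ le2 _ _] := tS n; apply: le_trans le2 _.
  by rewrite exprSr invfM mulrA ler_pM2r// invr_gt0.
have tnear n m : (n <= m)%N -> fnorm ((t m).1 - (t n).1) <= (t n).2 - (t m).2.
  move=> /subnK <-; elim: (m - n)%N => [|k IH].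
    by rewrite add0n !subrr fnorm0.
  have [_ _] := tS (k + n)%N; rewrite -[g _]/(t (k + n).+1) /= => le _.
  have := fnorm_dist (t (k + n)%N).1 (t (k + n).+1).1 (t n).1.
  lra.
have [|x tx] := @fnorm_complete R p p_gt0 X (fun n => (t n).1).
  move=> e e0; have [N NP] := half_pow_small 1 (divr_gt0 e0 (ltr0n R 2)).
  exists N => m n Nm Nn; have := fnorm_dist (t N).1 (t m).1 (t n).1.
  rewrite (fnormC (t N).1); have := tnear _ _ Nm; have := tnear _ _ Nn.
  have := t0 m; have := t0 n; have := t2 N; have := NP N (leqnn N); lra.
have [n En] := cover x.
have [_ _ _ /(_ x En)] := tS n; rewrite -[g _]/(t n.+1) ltNge => /negP; apply.
rewrite fnormC; apply: (@fcvg_fnorm_le _ _ _ (fun k => (t k).1 - (t n.+1).1)).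
  move=> e /tx[N NP]; exists N => k /NP.
  by rewrite opprB addrA subrK.
exists n.+1 => k /tnear; have := t0 k; lra.
Qed.

End Baire.

Section UnconditionalBasis.
Variables (R : realType) (p : R).
Hypothesis p_gt0 : 0 < p.
Variables (X : pBanachType p) (e : nat -> X).

Section Coordinates.
Variable a : X -> nat -> R.
Hypothesis aP : forall x, fcvg (fun N => \sum_(0 <= i < N) a x i *: e i) x.
Hypothesis a_uniq : forall x b,
  fcvg (fun N => \sum_(0 <= i < N) b i *: e i) x -> a x = b.

Let a_lin (c : R) x y i : a (c *: x + y) i = c * a x i + a y i.
Proof.
rewrite (@a_uniq _ (fun i => c * a x i + a y i))//.
have := fcvgD (fcvgZ c (@aP x)) (@aP y).
congr fcvg; apply/funext => N; rewrite scaler_sumr -big_split/=.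
by apply: eq_bigr => j _; rewrite scalerA scalerDl.
Qed.

Let P (B : pred nat) N x := \sum_(0 <= i < N | B i) a x i *: e i.

Let P_lin B N (c : R) x y : P B N (c *: x + y) = c *: P B N x + P B N y.
Proof.
rewrite /P scaler_sumr -big_split/=; apply: eq_bigr => i _.
by rewrite a_lin scalerDl scalerA.
Qed.

Let PD B N x y : P B N (x + y) = P B N x + P B N y.
Proof. by rewrite -[x in LHS]scale1r P_lin scale1r. Qed.

Let P0 B N : P B N 0 = 0.
Proof. by apply: (addrI (P B N 0)); rewrite -PD !addr0. Qed.

Let PZ B N (c : R) x : P B N (c *: x) = c *: P B N x.
Proof. by rewrite -[c *: x in LHS]addr0 P_lin P0 addr0. Qed.

Let PB B N x y : P B N (x - y) = P B N x - P B N y.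
Proof. by rewrite PD -scaleN1r PZ scaleN1r. Qed.

Let e_neq0 i : e i <> 0.
Proof.
have zero_coords b : (forall j, b j *: e j = 0) -> a 0 = b.
  move=> b0; apply: a_uniq.
  have -> : (fun N => \sum_(0 <= j < N) b j *: e j) = fun=> 0.
    by apply/funext => N; rewrite big1.
  exact: fcvg_cst.
move=> ei0; have a0 : a 0 = fun=> 0 by apply: zero_coords => j; rewrite scale0r.
have : a 0 = fun j => (j == i)%:R.
  by apply: zero_coords => j; case: eqVneq => [->|_]; rewrite ?ei0 ?scaler0// scale0r.
rewrite a0 => /(congr1 (fun f => f i))/eqP.
by rewrite eqxx eq_sym oner_eq0.
Qed.

(** The supremum of fnorm (P B N x) over B and N is a stronger norm, for which all the
    projections are bounded; the open mapping argument below shows that it is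
    equivalent to the original one. *)
Definition proj_bound (C : R) x := forall B N, fnorm (P B N x) <= C.

Let bdD C D x y : proj_bound C x -> proj_bound D y -> proj_bound (C + D) (x + y).
Proof. by move=> xC yD B N; rewrite PD; exact: le_trans (fnormD _ _) (lerD _ _). Qed.

Let bdB C D x y : proj_bound C x -> proj_bound D y -> proj_bound (C + D) (x - y).
Proof. by move=> xC yD B N; rewrite PB; exact: le_trans (fnormB _ _) (lerD _ _). Qed.

Let bdZ C (c : R) x : proj_bound C x -> proj_bound (`|c| `^ p * C) (c *: x).
Proof. by move=> xC B N; rewrite PZ fnormZ ler_wpM2l ?powR_ge0. Qed.

Let P_single i x : P (pred1 i) i.+1 x = a x i *: e i.
Proof.
rewrite /P big_mkcond big_nat_recr//= eqxx big_nat_cond big1 ?add0r// => j.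
by rewrite andbT => /andP[_ ji]; rewrite ltn_eqF.
Qed.

(** This is the completeness of the norm of [proj_bound], for geometric series: the
    coordinates of the partial sums converge, the expansion with the limit
    coordinates converges to y because the estimates are uniform in N, and it is
    the expansion of y by uniqueness. *)
Lemma proj_bound_series (C : R) (z : nat -> X) (y : X) : 0 <= C ->
  (forall j, proj_bound (C / 2 ^+ j) (z j)) ->
  fcvg (fun J => \sum_(0 <= j < J) z j) y -> proj_bound (2 * C) y.
Proof.
move=> C0 zC; set Y := (fun J => _) => Yy.
(* The tails of the series C / 2 ^+ j, summed exactly *)
have dY0 J k : proj_bound (2 * C / 2 ^+ J - 2 * C / 2 ^+ (k + J)) (Y (k + J)%N - Y J).
  elim: k => [|k IH].
    by rewrite add0n !subrr => B N; rewrite P0 fnorm0.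
  have -> : Y (k.+1 + J)%N - Y J = Y (k + J)%N - Y J + z (k + J)%N.
    by rewrite /Y addSn big_nat_recr// addrAC.
  move=> B N; apply: le_trans (bdD IH (zC _) B N) _.
  rewrite addSn exprSr invfM.
  by have := expf_neq0 (k + J) (_ : 2 != 0 :> R); lra.
have dY J K : (J <= K)%N -> proj_bound (2 * C / 2 ^+ J) (Y K - Y J).
  move=> /subnK <- B N; apply: le_trans (dY0 _ _ B N) _.
  by rewrite gerBl divr_ge0 ?exprn_ge0 ?mulr_ge0.
have /choice[al alP] : forall i, exists l, forall eps, 0 < eps ->
    exists N, forall n, (N <= n)%N -> `|a (Y n) i - l| < eps.
  move=> i; apply: real_cauchy_cvg => eps eps0.
  have ei0 := fnorm_gt0 (@e_neq0 i).
  have w0 : 0 < (eps / 2) `^ p * fnorm (e i) by rewrite mulr_gt0// powR_gt0; lra.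
  have [N NP] := half_pow_small (2 * C) w0.
  have near n : (N <= n)%N -> `|a (Y n) i - a (Y N) i| < eps / 2.
    move=> Nn; rewrite -(ltr_powp p_gt0)//; last lra.
    rewrite -(ltr_pM2r ei0) -fnormZ; apply: le_lt_trans (NP N (leqnn N)).
    have := dY _ _ Nn (pred1 i) i.+1.
    by rewrite PB !P_single -scalerBl.
  exists N => m n /near mN /near nN.
  rewrite -(subrK (a (Y N) i) (a (Y m) i)) -addrA.
  apply: le_lt_trans (ler_normD _ _) _; rewrite [X in _ + X]distrC; lra.
pose Q (B : pred nat) N := \sum_(0 <= i < N | B i) al i *: e i.
have PQ B N : fcvg (fun J => P B N (Y J)) (Q B N).
  by apply: (fcvg_sum p_gt0) => i _; apply: (fcvg_scale p_gt0); exact: alP.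
have QPle B N J : fnorm (Q B N - P B N (Y J)) <= 2 * C / 2 ^+ J.
  have := fcvgD (PQ B N) (fcvg_cst p_gt0 (- P B N (Y J))).
  move=> /fcvg_fnorm_le; apply; exists J => n Jn.
  by rewrite -PB; exact: dY.
have Qy : fcvg (Q predT) y.
  move=> eps eps0; have eps4 : 0 < eps / 4 by lra.
  have [J1 J1P] := half_pow_small (2 * C) eps4.
  have [J2 J2P] := Yy _ eps4.
  set J := maxn J1 J2.
  have [N NP] := aP (Y J) eps4.
  exists N => n /NP; rewrite -[X in fnorm (X - _) < _]/(P predT n (Y J)) => Nn.
  have := J1P _ (leq_maxl J1 J2); have := J2P _ (leq_maxr J1 J2); rewrite -/J.
  have := QPle predT n J.
  have := fnorm_dist (P predT n (Y J)) (Q predT n) y.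
  have := fnorm_dist (Y J) (P predT n (Y J)) y.
  lra.
have aE := a_uniq Qy.
move=> B N; have := QPle B N 0%N.
rewrite expr0 divr1 {1}/Y big_geq// P0 subr0; congr (fnorm _ <= _).
by apply: eq_bigr => i _; rewrite aE.
Qed.

Hypothesis a_bounded : forall x, exists C, proj_bound C x.

Let bd_ge0 C x : proj_bound C x -> 0 <= C.
Proof. by move=> /(_ predT 0%N); exact: le_trans (fnorm_ge0 _). Qed.

(** The open mapping argument. By Baire's theorem the vectors with
    proj_bound n%:R are dense in some ball, hence, taking differences, those with
    proj_bound (2 * n%:R) are dense in a ball around 0. Then y is the sum of
    successive approximations, each of half the size of the one before. *)
Lemma proj_bound_ball : exists C r, [/\ 0 <= C, 0 < r &
  forall y, fnorm y < r -> proj_bound C y].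
Proof.
have [|n [x0 [r [r0 dense]]]] :=
    @baire_somewhere_dense R p p_gt0 X (fun n => proj_bound n%:R).
  move=> x; have [C xC] := a_bounded x.
  exists (Num.bound C) => B N; apply: le_trans (xC B N) _.
  exact: ltW (archi_boundP (bd_ge0 xC)).
have dense0 y eta : fnorm y < r -> 0 < eta ->
    exists2 z, proj_bound (2 * n%:R) z & fnorm (y - z) < eta.
  move=> yr eta0; have eta2 : 0 < eta / 2 by lra.
  have [|z1 z1n yz1] := dense (x0 + y) _ _ eta2.
    by rewrite addrAC subrr add0r.
  have [|z2 z2n yz2] := dense x0 _ _ eta2; first by rewrite subrr fnorm0.
  exists (z1 - z2); first by rewrite mulr_natl mulr2n; exact: bdB.
  have := fnormB (x0 + y - z1) (x0 - z2).
  have -> : x0 + y - z1 - (x0 - z2) = y - (z1 - z2).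
    rewrite !opprB [x0 + y]addrC -(addrA y) -addrA; congr (_ + _).
    by rewrite [LHS]addrC addrA subrK.
  lra.
(* scaling by t halves fnorm *)
have [t t0 tp] : exists2 t : R, 0 < t & t `^ p = 1 / 2.
  have half0 : 0 < 1 / 2 :> R by lra.
  by exists ((1 / 2) `^ p^-1); [exact: powR_gt0|exact/powpVK/ltW].
have tX j : `|t ^+ j| `^ p = 1 / 2 ^+ j.
  elim: j => [|j IH]; first by rewrite !expr0 normr1 powR1 divr1.
  rewrite exprS normrM powRM// IH (ger0_norm (ltW t0)) tp exprS.
  by field; rewrite expf_neq0.
have /choice[h hP] : forall s : nat * X, exists z, fnorm s.2 < r / 2 ^+ s.1 ->
    proj_bound (2 * n%:R / 2 ^+ s.1) z /\ fnorm (s.2 - z) < r / 2 ^+ s.1.+1.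
  move=> [j y] /=; have [yr|] := boolP (fnorm y < r / 2 ^+ j); last by exists 0.
  have j0 : 0 < 2 ^+ j :> R by rewrite exprn_gt0.
  have tj0 : t ^+ j != 0 by rewrite expf_neq0// gt_eqF.
  have yE : y = t ^+ j *: ((t ^+ j)^-1 *: y) by rewrite scalerA divff// scale1r.
  have y'r : fnorm ((t ^+ j)^-1 *: y) < r.
    by move: yr; rewrite {1}yE fnormZ tX ltr_pdivlMr// mulrC mulrA mul1r divff ?gt_eqF// mul1r.
  have [z zn yz] := dense0 _ (r / 2) y'r (divr_gt0 r0 (ltr0n R 2)).
  exists (t ^+ j *: z) => _; split.
    by have := @bdZ _ (t ^+ j) _ zn; rewrite tX mulrC mulrA mulr1.
  rewrite {1}yE -scalerBr fnormZ tX mul1r mulrC ltr_pdivrMr//.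
  have -> // : r / 2 ^+ j.+1 * 2 ^+ j = r / 2.
  by rewrite exprS; field; rewrite gt_eqF.
exists (2 * (2 * n%:R)), r; split=> // y yr.
(* s j = the remainder after j successive approximations *)
pose s := fix s j := if j is i.+1 then s i - h (i, s i) else y.
have sr j : fnorm (s j) < r / 2 ^+ j.
  elim: j => [|j IH]; first by rewrite expr0 divr1.
  by have [] := hP (j, s j) IH.
apply: (@proj_bound_series _ (fun j => h (j, s j))).
- by rewrite mulr_ge0.
- by move=> j; have [] := hP (j, s j) (sr j).
have sumh J : \sum_(0 <= j < J) h (j, s j) = y - s J.
  elim: J => [|J IH]; first by rewrite big_geq// subrr.
  by rewrite big_nat_recr// IH /= opprB addrA addrAC.
move=> eps eps0; have [N NP] := half_pow_small r eps0.
exists N => m /NP; apply: lt_trans.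
by rewrite sumh addrAC subrr add0r fnormN.
Qed.

Lemma unconditional_basis_coordinates : exists K, [/\ 0 <= K,
   (forall c x y i, a (c *: x + y) i = c * a x i + a y i) &
   forall B N x,
     pnorm (\sum_(0 <= i < N | B i) a x i *: e i) <= K * pnorm x].
Proof.
have [C [r [C0 r0 Cr]]] := proj_bound_ball.
exists ((2 * C / r) `^ p^-1); split=> //; first exact: powR_ge0.
move=> B N x; rewrite -/(P B N x).
have [->|/eqP/fnorm_gt0 x0] := eqVneq x 0; first by rewrite P0 !pnorm0 mulr0.
have Cr0 : 0 <= 2 * C / r by rewrite divr_ge0 ?mulr_ge0// ltW.
rewrite -(ler_powp p_gt0) ?mulr_ge0 ?pnorm_ge0 ?powR_ge0// powRM ?pnorm_ge0 ?powR_ge0//.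
rewrite powpVK// -/(fnorm x) -/(fnorm (P B N x)).
have rx : 0 < r / 2 / fnorm x by rewrite !divr_gt0.
pose t := (r / 2 / fnorm x) `^ p^-1.
have tp : `|t| `^ p = r / 2 / fnorm x.
  by rewrite ger0_norm ?powR_ge0// powpVK// ltW.
have := @Cr (t *: x); rewrite fnormZ tp divfK ?gt_eqF//.
have r2 : r / 2 < r by lra.
move=> /(_ r2 B N); rewrite PZ fnormZ tp.
rewrite -ler_pdivlMl// => /le_trans; apply.
rewrite le_eqVlt; apply/orP; left; apply/eqP; field.
by rewrite !gt_eqF.
Qed.

End Coordinates.

(** What the rest of the proof uses of an unconditional basis: linear coordinates a,
    convergent expansions with unconditionally small tails, and projections onto
    finite sets of coordinates bounded by one constant. *)
Lemma unconditional_basis_projections : is_unconditional_basis e ->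
  exists (a : X -> nat -> R) (K : R), [/\ 0 <= K,
   (forall c x y i, a (c *: x + y) i = c * a x i + a y i),
   (forall x, fcvg (fun N => \sum_(0 <= i < N) a x i *: e i) x),
   (forall x eps, 0 < eps -> exists N, forall (B : pred nat) M,
     fnorm (\sum_(N <= i < M | B i) a x i *: e i) <= eps) &
   forall B N x,
     pnorm (\sum_(0 <= i < N | B i) a x i *: e i) <= K * pnorm x].
Proof.
move=> [/choice[a aP] eU]; exists a.
have aP1 x : fcvg (fun N => \sum_(0 <= i < N) a x i *: e i) x.
  by have [ax _] := aP x; exact/(pnorm_cvgP p_gt0).
have aP2 x b : fcvg (fun N => \sum_(0 <= i < N) b i *: e i) x -> a x = b.
  by have [_ ax] := aP x => bx; apply: ax; exact/(pnorm_cvgP p_gt0).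
have [x|K [K0 K1 K2]] := unconditional_basis_coordinates aP1 aP2.
  have [ax _] := aP x.
  by have := unconditional_bounded p_gt0 (eU x _ ax).
exists K; split=> // x eps eps0.
by have [ax _] := aP x; have := unconditional_tail p_gt0 (eU x _ ax) eps0.
Qed.

End UnconditionalBasis.

(** * Step functions, functionals and Rademacher functions *)

Section DyadicMeans.
Variable R : realType.
Implicit Types c d : nat -> R.

Lemma sum_double (V : nmodType) (n : nat) (G : nat -> V) :
  \sum_(0 <= i < n.*2) G i = \sum_(0 <= i < n) (G i.*2 + G i.*2.+1).
Proof.
elim: n => [|n IH]; first by rewrite !big_geq.
by rewrite doubleS 3?big_nat_recr//= IH addrA.
Qed.

Lemma expn2S L : (2 ^ L.+1 = (2 ^ L).*2)%N.
Proof. by rewrite expnS mul2n. Qed.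

(** A function c on nat stands for the step function on [0, 1[ with the values c i on
    the dyadic intervals [i / 2 ^ L, (i + 1) / 2 ^ L[, and mean L c is its integral. *)
Definition mean L c : R := (\sum_(0 <= i < 2 ^ L) c i) / 2 ^+ L.

Lemma pow2_gt0 L : 0 < 2 ^+ L :> R. Proof. by rewrite exprn_gt0. Qed.

Lemma meanS L c : mean L.+1 c = mean L (fun i => (c i.*2 + c i.*2.+1) / 2).
Proof. by rewrite /mean expn2S sum_double -mulr_suml exprS invfM mulrA. Qed.

Lemma meanD L c d : mean L (fun i => c i + d i) = mean L c + mean L d.
Proof. by rewrite /mean big_split mulrDl. Qed.

Lemma meanZ L a c : mean L (fun i => a * c i) = a * mean L c.
Proof. by rewrite /mean -mulr_sumr mulrA. Qed.

Lemma mean_cst L a : mean L (fun=> a) = a.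
Proof.
rewrite /mean sumr_const_nat subn0 -[a *+ _]mulr_natl natrX mulrAC.
by rewrite divff ?mul1r// gt_eqF// pow2_gt0.
Qed.

Lemma eq_mean L c d : (forall i, (i < 2 ^ L)%N -> c i = d i) -> mean L c = mean L d.
Proof.
by move=> cd; congr (_ / _); apply: eq_big_nat => i /andP[_]; exact: cd.
Qed.

Lemma le_mean L c d : (forall i, (i < 2 ^ L)%N -> c i <= d i) -> mean L c <= mean L d.
Proof.
move=> cd; rewrite ler_pM2r ?invr_gt0 ?pow2_gt0//.
by apply: ler_sum_nat => i /andP[_]; exact: cd.
Qed.

Lemma norm_mean L c : `|mean L c| <= mean L (fun i => `|c i|).
Proof.
rewrite /mean normrM [X in _ * X]ger0_norm ?invr_ge0 ?exprn_ge0//.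
by rewrite ler_pM2r ?invr_gt0 ?pow2_gt0// ler_norm_sum.
Qed.

(** The step function c of level L, seen at the level k + L *)
Lemma mean_refine L k c : mean (k + L) (fun i => c (i %/ 2 ^ k)%N) = mean L c.
Proof.
elim: k => [|k IH]; first by apply: eq_mean => i _; rewrite divn1.
rewrite addSn meanS -IH; apply: eq_mean => i _.
rewrite expnS !divnMA !divn2 doubleK -uphalfE uphalf_double.
by lra.
Qed.

(** The step function c of level L times the Rademacher function of level k + L + 1,
    as a step function of the level k + L + 1 *)
Definition rademacher k c i : R := c (i %/ 2 ^ k.+1)%N * (-1) ^+ i.

Lemma rademacher_even k c i : rademacher k c i.*2 = c (i %/ 2 ^ k)%N.
Proof.
by rewrite /rademacher expnS divnMA divn2 doubleK -signr_odd odd_double mulr1.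
Qed.

Lemma rademacher_odd k c i : rademacher k c i.*2.+1 = - c (i %/ 2 ^ k)%N.
Proof.
rewrite /rademacher expnS divnMA divn2 -uphalfE uphalf_double.
by rewrite -signr_odd /= odd_double mulrN1.
Qed.

Lemma mean_rademacher k L c : mean (k + L).+1 (rademacher k c) = 0.
Proof.
rewrite meanS -[RHS](mean_cst (k + L)); apply: eq_mean => i _.
by rewrite rademacher_even rademacher_odd subrr mul0r.
Qed.

End DyadicMeans.

Section Functionals.
Variables (R : realType) (p : R) (F : pNormedType p).

Definition bounded_functional (K : R) (phi : F -> R) : Prop :=
  (forall c x y, phi (c *: x + y) = c * phi x + phi y) /\
  forall x, `|phi x| <= K * pnorm x.

Section Linearity.
Variables (K : R) (phi : F -> R).
Hypothesis bphi : bounded_functional K phi.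

Lemma functionalD x y : phi (x + y) = phi x + phi y.
Proof. by have [lin _] := bphi; rewrite -[x in LHS]scale1r lin mul1r. Qed.

Lemma functional0 : phi 0 = 0.
Proof. by apply: (addrI (phi 0)); rewrite -functionalD !addr0. Qed.

Lemma functionalZ c x : phi (c *: x) = c * phi x.
Proof. by have [lin _] := bphi; rewrite -[c *: x]addr0 lin functional0 addr0. Qed.

Lemma functionalN x : phi (- x) = - phi x.
Proof. by rewrite -scaleN1r functionalZ mulN1r. Qed.

Lemma functionalB x y : phi (x - y) = phi x - phi y.
Proof. by rewrite functionalD functionalN. Qed.

Lemma functional_sum (I : Type) (s : seq I) (P : pred I) (f : I -> F) :
  phi (\sum_(i <- s | P i) f i) = \sum_(i <- s | P i) phi (f i).
Proof. exact: (big_morph phi functionalD functional0). Qed.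

End Linearity.

(** The norm of v in the Banach envelope of F is at most r: all the estimates of the
    gliding hump are needed after the application of a functional only. *)
Definition weak_le (v : F) (r : R) : Prop :=
  forall phi, bounded_functional 1 phi -> `|phi v| <= r.

Lemma weak_leD v w r s : weak_le v r -> weak_le w s -> weak_le (v + w) (r + s).
Proof.
move=> vr ws phi b; rewrite (functionalD b).
exact: le_trans (ler_normD _ _) (lerD (vr _ b) (ws _ b)).
Qed.

Lemma weak_leN v r : weak_le v r -> weak_le (- v) r.
Proof. by move=> vr phi b; rewrite (functionalN b) normrN; exact: vr. Qed.

Lemma weak_le_pnorm v : weak_le v (pnorm v).
Proof. by move=> phi [_ /(_ v)]; rewrite mul1r. Qed.

Lemma weak_leW v r s : r <= s -> weak_le v r -> weak_le v s.
Proof. by move=> rs vr phi b; exact: le_trans (vr _ b) rs. Qed.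

Lemma weak_le_sum (s : seq nat) (P : pred nat) (f : nat -> F) :
  weak_le (\sum_(i <- s | P i) f i) (\sum_(i <- s | P i) pnorm (f i)).
Proof.
move=> phi b; rewrite (functional_sum b); apply: le_trans (ler_norm_sum _ _ _) _.
by apply: ler_sum => i _; exact: weak_le_pnorm.
Qed.

End Functionals.

Section UnitIntervalCurve.
Variables (R : realType) (p : R) (p_gt0 : 0 < p) (p_le1 : p <= 1).
Local Notation I := (unit_interval p_gt0 p_le1).
Variables (F : pBanachType p) (delta : I -> F).
Hypothesis hF : is_lipschitz_free delta.

(** Real numbers are more convenient than the points of the unit interval: outside
    [0, 1] the value is the base point. *)
Definition point (x : R) : I := insubd (base_point I : {x : R | x \in `[0, 1]}) x.
Definition curve (x : R) : F := delta (point x).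

Lemma pointK (t : I) : point (sval t) = t.
Proof. exact: valKd. Qed.

Lemma val_point x : 0 <= x <= 1 -> sval (point x) = x.
Proof.
move=> x01; rewrite /point.
have := @insubdK _ _ _ (base_point I : {x : R | x \in `[0, 1]}) x.
by apply; change (x \in `[0, 1]); rewrite in_itv.
Qed.

Lemma sval01 (t : I) : 0 <= sval t <= 1.
Proof. by case: t => t t01; have := t01; rewrite in_itv. Qed.

Lemma curve_dist x y : 0 <= x <= 1 -> 0 <= y <= 1 ->
  pnorm (curve x - curve y) = `|x - y|.
Proof.
move=> x01 y01; have [dist _ _] := hF; rewrite dist.
by rewrite -[pdist _ _]/`|sval (point x) - sval (point y)| !val_point.
Qed.

Lemma curve0 : curve 0 = 0.
Proof.
have [_ <- _] := hF; congr delta; apply: val_inj.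
by apply: (@val_point 0); rewrite lexx ler01.
Qed.

(** The universal property for maps into the real line: Lipschitz functions are the
    functionals on F. *)
Lemma functional_extension (g : R -> R) (K : R) : 0 <= K -> g 0 = 0 ->
  (forall x y : R, 0 <= x -> x <= y -> y <= 1 -> `|g y - g x| <= K * (y - x)) ->
  exists phi, bounded_functional K phi /\
    forall x, 0 <= x <= 1 -> phi (curve x) = g x.
Proof.
move=> K0 g0 gK.
pose f (t : I) : real_line p_gt0 p_le1 := g (sval t).
have gK' (x y : R) : 0 <= x <= 1 -> 0 <= y <= 1 -> `|g x - g y| <= K * `|x - y|.
  move=> /andP[x0 x1] /andP[y0 y1]; have [xy|/ltW yx] := leP x y.
    by rewrite distrC [in leRHS]distrC [X in _ * X]ger0_norm ?subr_ge0// gK.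
  by rewrite [X in _ * X]ger0_norm ?subr_ge0// gK.
have [||T [Td Tn]] := free_extension hF (f := f) K0.
- by move=> x y; rewrite pnorm_real_line; apply: gK'; exact: sval01.
- by rewrite /f /= g0.
exists (fun v => T v : R); split.
  split=> [c x y|x]; first by rewrite linearP.
  exact: Tn.
by move=> x x01; rewrite Td /f val_point.
Qed.

Definition gap L i : F := curve (i.+1%:R / 2 ^+ L) - curve (i%:R / 2 ^+ L).

(** The canonical map from step functions to F, which sends the indicator function of
    [x, y[ to curve y - curve x *)
Definition molecule L (c : nat -> R) : F :=
  \sum_(0 <= i < 2 ^ L) c i *: gap L i.

Lemma dyadic01 L i : (i <= 2 ^ L)%N -> 0 <= (i%:R / 2 ^+ L : R) <= 1.
Proof.
move=> iL; rewrite divr_ge0 ?exprn_ge0//=.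
by rewrite ler_pdivrMr ?pow2_gt0// mul1r -natrX ler_nat.
Qed.

Lemma pnorm_gap L i : (i < 2 ^ L)%N -> pnorm (gap L i) = 1 / 2 ^+ L.
Proof.
move=> iL; rewrite curve_dist ?dyadic01//; last exact: ltnW.
by rewrite -mulrBl -natr1 addrAC subrr add0r ger0_norm.
Qed.

Lemma gapS L i : gap L i = gap L.+1 i.*2 + gap L.+1 i.*2.+1.
Proof.
have half j : j.*2%:R / 2 ^+ L.+1 = j%:R / 2 ^+ L :> R.
  by rewrite exprS invfM mulrA -muln2 natrM mulfK.
by rewrite /gap -doubleS !half [RHS]addrC addrA subrK.
Qed.

Lemma molecule_refine L k c :
  molecule (k + L) (fun i => c (i %/ 2 ^ k)%N) = molecule L c.
Proof.
elim: k => [|k IH]; first by apply: eq_bigr => i _; rewrite divn1.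
rewrite addSn -IH /molecule expn2S sum_double; apply: eq_bigr => i _.
rewrite expnS !divnMA !divn2 doubleK -uphalfE uphalf_double.
by rewrite -scalerDr -gapS.
Qed.

Lemma moleculeD L c d :
  molecule L (fun i => c i + d i) = molecule L c + molecule L d.
Proof.
by rewrite /molecule -big_split; apply: eq_bigr => i _; rewrite scalerDl.
Qed.

Section Slopes.
Variables (K : R) (phi : F -> R).
Hypothesis bphi : bounded_functional K phi.

(** The slopes of the polygonal interpolation at level L of the Lipschitz function
    phi \o curve, in other words the conditional expectation of its derivative *)
Definition slope L i : R := phi (gap L i) * 2 ^+ L.

Lemma slope_le L i : (i < 2 ^ L)%N -> `|slope L i| <= K.
Proof.
move=> iL; have [_ /(_ (gap L i))] := bphi.
rewrite pnorm_gap// normrM [X in _ -> _ * X <= _]ger0_norm ?exprn_ge0// mulrA mulr1.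
by rewrite ler_pdivlMr ?pow2_gt0.
Qed.

Lemma slopeS L i : slope L i = (slope L.+1 i.*2 + slope L.+1 i.*2.+1) / 2.
Proof. by rewrite /slope gapS (functionalD bphi) exprS; lra. Qed.

Lemma functional_molecule L c : phi (molecule L c) = mean L (fun i => c i * slope L i).
Proof.
rewrite (functional_sum bphi) /mean mulr_suml; apply: eq_bigr => i _.
by rewrite (functionalZ bphi) /slope mulrA mulfK// gt_eqF ?pow2_gt0.
Qed.

(** The L^1 norm of c dominates the envelope norm of its molecule. *)
Lemma functional_molecule_le L c : `|phi (molecule L c)| <= K * mean L (fun i => `|c i|).
Proof.
rewrite functional_molecule; apply: le_trans (norm_mean _ _) _.
rewrite -meanZ; apply: le_mean => i iL; rewrite normrM mulrC.
by rewrite ler_wpM2r ?slope_le.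
Qed.

Definition energy L : R := mean L (fun i => slope L i ^+ 2).
Definition slope_jump L i : R := (slope L.+1 i.*2 - slope L.+1 i.*2.+1) / 2.

(** Orthogonality of the increments of the martingale of slopes *)
Lemma energyS L : energy L.+1 = energy L + mean L (fun i => slope_jump L i ^+ 2).
Proof.
rewrite /energy meanS -meanD; apply: eq_mean => i _.
by rewrite (slopeS L) /slope_jump; field.
Qed.

Lemma energy_le L : energy L <= K ^+ 2.
Proof.
rewrite -[leRHS](mean_cst L); apply: le_mean => i iL.
rewrite -[slope L i ^+ 2]ger0_norm ?sqr_ge0// normrX lerXn2r ?nnegrE ?slope_le//.
exact: le_trans (slope_le iL).
Qed.

(** The energies increase and are bounded, so that their differences, which are the
    mean squares of the jumps, tend to 0. *)
Lemma slope_jump_small eps : 0 < eps -> exists L0, forall L, (L0 <= L)%N ->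
  mean L (fun i => `|slope_jump L i|) <= eps.
Proof.
move=> eps0; have [eta eta0 ->] : exists2 eta, 0 < eta & eps = eta + eta.
  by exists (eps / 2); lra.
have jump_ge0 L : 0 <= mean L (fun i => slope_jump L i ^+ 2).
  by rewrite -[leLHS](mean_cst L); apply: le_mean => i _; exact: sqr_ge0.
have : cvgn energy.
  apply: nondecreasing_is_cvgn.
    by apply/nondecreasing_seqP => L; rewrite energyS lerDl.
  by exists (K ^+ 2) => _ [L _ <-]; exact: energy_le.
have eta2 : 0 < eta ^+ 2 / 2 by rewrite divr_gt0 ?exprn_gt0.
move=> /cvgrPdist_lt/(_ _ eta2)[L0 _ L0P]; exists L0 => L L0L.
have jump_le : mean L (fun i => slope_jump L i ^+ 2) <= eta ^+ 2.
  have := L0P L L0L; have /= := L0P L.+1 (leqW L0L).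
  rewrite energyS !ltr_norml; lra.
(* t <= eta + t ^ 2 / eta turns the bound on squares into one on absolute values *)
apply: (@le_trans _ _ (mean L (fun i => eta + eta^-1 * slope_jump L i ^+ 2))).
  apply: le_mean => i _; have := normr_ge0 (slope_jump L i).
  rewrite -[X in _ * X]ger0_norm ?sqr_ge0// normrX.
  move: `|_| => t t0; have -> : eta + eta^-1 * t ^+ 2 = (eta ^+ 2 + t ^+ 2) / eta.
    by field; rewrite gt_eqF.
  by rewrite ler_pdivlMr//; nra.
rewrite meanD meanZ mean_cst.
by rewrite lerD2l ler_pdivrMl// -expr2.
Qed.

Lemma functional_rademacher L c k : phi (molecule (k + L).+1 (rademacher k c)) =
  mean (k + L) (fun i => c (i %/ 2 ^ k)%N * slope_jump (k + L) i).
Proof.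
rewrite functional_molecule meanS; apply: eq_mean => i _.
by rewrite rademacher_even rademacher_odd /slope_jump; field.
Qed.

(** This is the Riemann-Lebesgue lemma for the derivative of phi \o curve, and it is
    proved without differentiating: against a Rademacher function of a given level, the
    derivative counts through the jumps of its slopes at that level only. *)
Lemma rademacher_weakly_null L c eps : 0 < eps -> exists k0, forall k, (k0 <= k)%N ->
  `|phi (molecule (k + L).+1 (rademacher k c))| <= eps.
Proof.
move=> eps0; pose C := \sum_(0 <= i < 2 ^ L) `|c i| + 1.
have cC i : (i < 2 ^ L)%N -> `|c i| <= C.
  move=> iL; rewrite /C big_mkord (bigD1 (Ordinal iL))//= -addrA lerDl.
  by rewrite addr_ge0 ?sumr_ge0.
have C0 : 0 < C.
  by rewrite /C -[ltLHS]addr0 ler_ltD ?ltr01// sumr_ge0.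
have [k0 k0P] := slope_jump_small (divr_gt0 eps0 C0).
exists k0 => k k0k; rewrite functional_rademacher.
apply: le_trans (norm_mean _ _) _.
apply: (@le_trans _ _ (C * mean (k + L) (fun i => `|slope_jump (k + L) i|))).
  rewrite -meanZ; apply: le_mean => i iL; rewrite normrM ler_wpM2r// cC//.
  by rewrite ltn_divLR ?expn_gt0// -expnD addnC.
by rewrite -ler_pdivlMl// mulrC k0P// (leq_trans k0k)// leq_addr.
Qed.

End Slopes.

(** Conversely, L^infinity is contained in the dual of F: the functional with slopes d
    comes from the primitive of the step function d. *)
Lemma functional_with_slopes L (d : nat -> R) : (forall i, `|d i| <= 1) ->
  exists2 phi, bounded_functional 1 phi &
    forall c, phi (molecule L c) = mean L (fun i => d i * c i).
Proof.
move=> d1; pose x i : R := i%:R / 2 ^+ L.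
have xle i j : (i <= j)%N -> x i <= x j.
  by move=> ij; rewrite ler_pM2r ?invr_gt0 ?pow2_gt0// ler_nat.
(* g is the primitive of the step function d: piece i is the length of the
   part of the i-th dyadic interval that lies on the left of t *)
pose piece i t : R := Num.min t (x i.+1) - Num.min t (x i).
pose g t := \sum_(0 <= i < 2 ^ L) d i * piece i t.
have piece_sum t : 0 <= t <= 1 -> \sum_(0 <= i < 2 ^ L) piece i t = t.
  move=> /andP[t0 t1]; rewrite telescope_sumr// /x mul0r natrX divff ?gt_eqF ?pow2_gt0//.
  by rewrite (min_l t1) (min_r t0) subr0.
have piece_mono i s t : s <= t -> piece i s <= piece i t.
  move=> st; have := xle i i.+1 (leqnSn i); rewrite /piece.
  move: (x i) (x i.+1) => a b.
  case: (leP s a); case: (leP s b); case: (leP t a); case: (leP t b); lra.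
have [||t u t0 tu u1|phi [bphi phig]] := @functional_extension g 1.
- exact: ler01.
- rewrite /g big1// => i _; rewrite /piece !min_l ?subrr ?mulr0//.
    by rewrite divr_ge0 ?exprn_ge0.
  by rewrite divr_ge0 ?exprn_ge0.
- rewrite /g -sumrB; apply: le_trans (ler_norm_sum _ _ _) _.
  have t1 := le_trans tu u1; have u0 := le_trans t0 tu.
  have -> : 1 * (u - t) = \sum_(0 <= i < 2 ^ L) (piece i u - piece i t).
    by rewrite sumrB mul1r !piece_sum ?t0 ?u0.
  apply: ler_sum => i _; rewrite -mulrBr normrM.
  rewrite -[leRHS]mul1r [X in _ * X]ger0_norm ?subr_ge0 ?piece_mono//.
  by rewrite ler_wpM2r ?subr_ge0 ?piece_mono.
exists phi => // c; rewrite (functional_molecule bphi); apply: eq_mean => j jL.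
rewrite mulrC; congr (_ * _); rewrite /slope (functionalB bphi).
rewrite !phig ?dyadic01//; last exact: ltnW.
rewrite -[j.+1%:R / _]/(x j.+1) -[j%:R / _]/(x j) /g -sumrB.
rewrite big_mkord (bigD1 (Ordinal jL))//= big1 ?addr0 => [|i ij].
  have := xle j j.+1 (leqnSn j) => jj.
  rewrite /piece minxx (min_r jj) (min_l jj) minxx subrr mulr0 subr0 -mulrA.
  by rewrite /x -mulrBl -natr1 addrAC subrr add0r mul1r mulVf ?mulr1// gt_eqF ?pow2_gt0.
rewrite -mulrBr /piece; apply/eqP; rewrite mulf_eq0; apply/orP; right.
have [ltij|ltji|eqij] := ltngtP i j; last by move: ij; rewrite -val_eqE /= eqij eqxx.
  have := xle _ _ ltij; have := xle _ _ (leqnSn i); have := xle _ _ (leqnSn j).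
  move=> h1 h2 h3; rewrite !min_r; lra.
have := xle _ _ ltji; have := xle _ _ (leqnSn i); have := xle _ _ (leqnSn j).
move=> h1 h2 h3; rewrite !min_l; lra.
Qed.

End UnitIntervalCurve.

(** * The gliding hump *)

Section NoUnconditionalBasis.
Variables (R : realType) (p : R) (p_gt0 : 0 < p) (p_le1 : p <= 1).
Local Notation I := (unit_interval p_gt0 p_le1).
Variables (F : pBanachType p) (delta : I -> F).
Hypothesis hF : is_lipschitz_free delta.
Local Notation molecule := (molecule delta).

Section GlidingHump.
Variables (e : nat -> F) (a : F -> nat -> R) (K : R).
Hypothesis a_lin : forall c x y i, a (c *: x + y) i = c * a x i + a y i.
Hypothesis a_cvg : forall x, fcvg (fun N => \sum_(0 <= i < N) a x i *: e i) x.
Hypothesis a_tail : forall x eps, 0 < eps -> exists N, forall (B : pred nat) M,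
  fnorm (\sum_(N <= i < M | B i) a x i *: e i) <= eps.
Hypothesis a_proj : forall B N x,
  pnorm (\sum_(0 <= i < N | B i) a x i *: e i) <= K * pnorm x.

Let T (B : pred nat) N M x := \sum_(N <= i < M | B i) a x i *: e i.

Let T_lin B N M c x y : T B N M (c *: x + y) = c *: T B N M x + T B N M y.
Proof.
rewrite /T scaler_sumr -big_split/=; apply: eq_bigr => i _.
by rewrite a_lin scalerDl scalerA.
Qed.

Let TD B N M x y : T B N M (x + y) = T B N M x + T B N M y.
Proof. by rewrite -[x in LHS]scale1r T_lin scale1r. Qed.

Let weak_small (x : F) eps : 0 < eps -> fnorm x <= eps `^ p -> weak_le x eps.
Proof.
move=> eps0; rewrite ler_powp ?pnorm_ge0 ?(ltW eps0)// => xe.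
exact: weak_leW xe (@weak_le_pnorm _ _ _ x).
Qed.

Let coordinate_functional i : bounded_functional K (fun x => a x i * pnorm (e i)).
Proof.
split=> [c x y|x]; first by rewrite a_lin mulrDl mulrA.
have := a_proj (pred1 i) i.+1 x.
rewrite big_mkcond big_nat_recr//= eqxx big_nat_cond big1 ?add0r.
  by rewrite pnormZ normrM [`|pnorm _|]ger0_norm ?pnorm_ge0.
by move=> j; rewrite andbT => /andP[_ ji]; rewrite ltn_eqF.
Qed.

Lemma rademacher_coordinates_small L c N eps : 0 < eps ->
  exists k0, forall k, (k0 <= k)%N -> \sum_(0 <= i < N)
    pnorm (a (molecule (k + L).+1 (rademacher k c)) i *: e i) <= eps.
Proof.
elim: N eps => [|N IH] eps eps0.
  by exists 0%N => k _; rewrite big_geq// ltW.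
have eps2 : 0 < eps / 2 by lra.
have [k1 k1P] := IH _ eps2.
have [k2 k2P] := rademacher_weakly_null hF (coordinate_functional N) L c eps2.
exists (maxn k1 k2) => k; rewrite geq_max => /andP[/k1P le1 /k2P le2].
rewrite big_nat_recr//=; move: le2.
rewrite normrM [`|pnorm _|]ger0_norm ?pnorm_ge0// -pnormZ; lra.
Qed.

(** One more oscillation f of the step function c: with k large, f has small coordinates
    before N, and with N' large, the coordinates of f and of c + f after N' are
    negligible. *)
Lemma oscillation L c N eps : 0 < eps -> exists k N',
  let f := molecule (k + L).+1 (rademacher k c) in
  let h := molecule (k + L).+1 (fun i => c (i %/ 2 ^ k.+1)%N + rademacher k c i) in
  [/\ (N <= N')%N,
      (forall B, weak_le (T B 0 N f) eps),
      weak_le (T predT 0 N' f - f) eps &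
      forall B M, weak_le (T B N' M h) eps].
Proof.
move=> eps0; have [k kP] := rademacher_coordinates_small L c N eps0.
have epsp := powR_gt0 p eps0.
set f := molecule (k + L).+1 (rademacher k c).
set h := molecule (k + L).+1 (fun i => c (i %/ 2 ^ k.+1)%N + rademacher k c i).
have [N1 N1P] := a_cvg f epsp.
have [N2 N2P] := a_tail h epsp.
exists k, (maxn N (maxn N1 N2)); rewrite -/f -/h /=; set N' := maxn _ _.
split=> [|B||B M]; first exact: leq_maxl.
- apply: weak_leW (kP k (leqnn k)) _.
  apply: weak_leW (weak_le_sum _ _ _).
  rewrite big_mkcond; apply: ler_sum => i _.
  by case: ifP => // _; exact: pnorm_ge0.
- apply: weak_small => //; apply/ltW/N1P.
  by rewrite /N' !leq_max leqnn orbT.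
apply: weak_small => //.
have N2N' : (N2 <= N')%N by rewrite /N' !leq_max leqnn !orbT.
have [MN'|/ltnW N'M] := leqP M N'.
  by rewrite /T big_geq// fnorm0// ltW.
have := N2P (fun i => B i && (N' <= i)%N) M.
rewrite (big_cat_nat N2N' N'M)/= big_nat_cond big_pred0 ?add0r; last first.
  by move=> i; case: leqP => //; rewrite ?andbF// ltnNge => ->; rewrite !andbF.
rewrite /T big_nat_cond [in X in _ -> X]big_nat_cond.
congr (fnorm _ <= _); apply: eq_bigl => i.
by case: (leqP N' i); rewrite ?andbT.
Qed.

(** The situation after some steps. The step function h is equal to H on a set of measure
    1 / H, and to 0 elsewhere; s is the sum of the increments that have been kept,
    and it is equal to c on this set. Up to r, the projection of h onto the
    coordinates of A before N is s, and h is negligible after N. The function d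
    records where s is known to be large and negative, so that w bounds below
    the L^1 norm of s. *)
Definition gliding_state (eps H c w r : R) : Prop :=
  exists L h s d N A, [/\ [/\ mean L h = 1,
    (forall i, h i = 0 \/ [/\ h i = H, s i = c & d i = 0]),
    (forall i, `|d i| <= 1) & w <= mean L (fun i => d i * s i)],
    weak_le (T A 0 N (molecule L h) - molecule L s) r &
    forall B M, weak_le (T B N M (molecule L h)) eps].

Lemma gliding_start eps : 0 < eps -> gliding_state eps 1 0 0 0.
Proof.
move=> eps0; have [N NP] := a_tail (molecule 0 (fun=> 1)) (powR_gt0 p eps0).
exists 0%N, (fun=> 1), (fun=> 0), (fun=> 0), N, pred0; split.
- split; rewrite ?mean_cst ?mul0r//; first by right.
  by move=> _; rewrite normr0.
- rewrite /T big_pred0// sub0r; apply: weak_leN.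
  rewrite /molecule big1 => [|i _]; last by rewrite scale0r.
  by move=> phi b; rewrite (functional0 b) normr0.
- by move=> B M; apply: weak_small => //; exact: NP.
Qed.

Let half_splits (h : nat -> R) k i :
  h (i %/ 2 ^ k.+1)%N + rademacher k h i =
    if odd i then 0 else 2 * h (i %/ 2 ^ k.+1)%N.
Proof.
by rewrite /rademacher -signr_odd; case: (odd i); rewrite ?expr1 ?expr0; lra.
Qed.

(** Replace h by h + f with f = h r, and do not select the coordinates between N and N'. *)
Lemma gliding_skip eps H c w r : 0 < eps ->
  gliding_state eps H c w r -> gliding_state eps (2 * H) c w (r + eps).
Proof.
move=> eps0 [L [h [s [d [N [A [[hm hs d1 wd] hr ht]]]]]]].
have [k [N' [NN' f1 f2 f3]]] := oscillation L h N eps0.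
exists (k + L).+1, (fun i => h (i %/ 2 ^ k.+1)%N + rademacher k h i),
  (fun i => s (i %/ 2 ^ k.+1)%N), (fun i => d (i %/ 2 ^ k.+1)%N), N',
  (fun i => (i < N)%N && A i).
rewrite moleculeD -!addSn !molecule_refine; split; [split| |].
- by rewrite meanD mean_refine addSn mean_rademacher addr0.
- move=> i; rewrite half_splits; case: ifP => _; first by left.
  by case: (hs (i %/ 2 ^ k.+1)%N) => [->|[-> -> ->]]; [left; rewrite mulr0|right].
- by move=> i.
- by rewrite (mean_refine _ _ (fun j => d j * s j)).
- have -> : T (fun i => (i < N)%N && A i) 0 N'
      (molecule L h + molecule (k.+1 + L) (rademacher k h)) =
      T A 0 N (molecule L h) + T A 0 N (molecule (k + L).+1 (rademacher k h)).
    rewrite -TD addSn; move: (_ + _) => x.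
    rewrite /T (big_cat_nat (leq0n N) NN')/= [X in _ + X]big_nat_cond [X in _ + X]big_pred0.
      rewrite addr0 big_nat_cond [RHS]big_nat_cond.
      by apply: eq_bigl => i; case: (i < N)%N; rewrite ?andbT ?andbF.
    by move=> i; case: (ltnP i N) => [iN|]; rewrite ?andbF// leqNgt iN.
  by rewrite addrAC; apply: weak_leD.
- by have := f3; rewrite moleculeD -!addSn molecule_refine.
Qed.

(** Replace h by h + f and s by s + f, and select all the coordinates between N and N'.
    The hypothesis on c makes s + f large and negative where r = -1. *)
Lemma gliding_take eps H c w r : 0 < eps -> 0 < H -> c <= H / 3 ->
  gliding_state eps H c w r ->
  gliding_state eps (2 * H) (c + H) (w + 1 / 3) (r + 4 * eps).
Proof.
move=> eps0 H0 cH [L [h [s [d [N [A [[hm hs d1 wd] hr ht]]]]]]].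
have [k [N' [NN' f1 f2 f3]]] := oscillation L h N eps0.
exists (k + L).+1, (fun i => h (i %/ 2 ^ k.+1)%N + rademacher k h i),
  (fun i => s (i %/ 2 ^ k.+1)%N + rademacher k h i),
  (fun i => if odd i && (h (i %/ 2 ^ k.+1)%N != 0) then -1 else d (i %/ 2 ^ k.+1)%N), N',
  (fun i => (N <= i)%N || A i).
rewrite !moleculeD -!addSn !molecule_refine; split; [split| |].
- by rewrite meanD mean_refine addSn mean_rademacher addr0.
- move=> i; rewrite half_splits /rademacher -signr_odd; case: (odd i) => /=; first by left.
  case: (hs (i %/ 2 ^ k.+1)%N) => [->|[-> -> ->]]; [left; rewrite mulr0//|right].
  by rewrite expr0 mulr1.
- by move=> i; case: ifP => _ //; rewrite normrN1.
(* Where h = H and r = -1, that is for one half of the mean of h, the new s is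
   c - H <= - (2 / 3) H, and the new d is -1. *)
- apply: (@le_trans _ _ (mean (k.+1 + L) (fun i =>
     d (i %/ 2 ^ k.+1)%N * s (i %/ 2 ^ k.+1)%N +
     1 / 3 * (h (i %/ 2 ^ k.+1)%N + -1 * rademacher k h i)))).
    rewrite meanD (mean_refine _ _ (fun j => d j * s j)) meanZ meanD mean_refine meanZ.
    by rewrite hm addSn mean_rademacher; lra.
  apply: le_mean => i _; rewrite /rademacher -signr_odd.
  case: (hs (i %/ 2 ^ k.+1)%N) => [->|[-> -> ->]].
    by rewrite eqxx andbF; lra.
  rewrite gt_eqF// andbT; case: (odd i); rewrite ?expr1 ?expr0; lra.
- rewrite addSn in f1 f2 f3 *; set f := molecule _ (rademacher k h) in f1 f2 f3 *.
  set g := molecule L h; set t := molecule L s.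
  have -> : T (fun i => (N <= i)%N || A i) 0 N' (g + f) =
      T A 0 N g + T A 0 N f + T predT N N' g + T predT N N' f.
    rewrite -TD -addrA -TD; move: (g + f) => x.
    rewrite /T (big_cat_nat (leq0n N) NN')/=; congr (_ + _).
      rewrite big_nat_cond [RHS]big_nat_cond; apply: eq_bigl => i.
      by case: ltnP => //=; rewrite andbF.
    rewrite big_nat_cond [RHS]big_nat_cond; apply: eq_bigl => i.
    by case: (N <= i)%N; rewrite ?andbT ?andbF.
  have fE : T predT 0 N' f = T predT 0 N f + T predT N N' f.
    by rewrite /T (big_cat_nat (leq0n N) NN').
  have -> : T A 0 N g + T A 0 N f + T predT N N' g + T predT N N' f - (t + f) =
      (T A 0 N g - t) + (T A 0 N f + (T predT N N' g +
       ((T predT 0 N' f - f) + - T predT 0 N f))).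
    rewrite fE [X in _ + (_ + (_ + X))]addrAC [T predT 0 N f + _]addrC addrK opprD !addrA.
    congr (_ - _); do 2 (rewrite [LHS]addrAC; congr (_ + _)).
    by rewrite [LHS]addrAC.
  have -> : r + 4 * eps = r + (eps + (eps + (eps + eps))) by lra.
  by do !apply: weak_leD => //; apply: weak_leN.
- by have := f3; rewrite moleculeD -!addSn molecule_refine.
Qed.

(** A skip and a take multiply H by 4 and replace c by c + 2 H, which preserves
    c <= 2 / 3 * H, while the skip makes this bound c <= H / 3 in terms of the new H. *)
Lemma gliding_states eps m : 0 < eps -> exists H c, [/\ 0 < H, c <= 2 / 3 * H &
  gliding_state eps H c (m%:R / 3) (m%:R * (5 * eps))].
Proof.
move=> eps0; elim: m => [|m [H [c [H0 cH st]]]].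
  exists 1, 0; split; [by []|lra|].
  by rewrite !mul0r; exact: gliding_start.
exists (2 * (2 * H)), (c + 2 * H); split; [lra|lra|].
have -> : m.+1%:R / 3 = m%:R / 3 + 1 / 3 :> R by rewrite -natr1; lra.
have -> : m.+1%:R * (5 * eps) = m%:R * (5 * eps) + eps + 4 * eps.
  by rewrite -natr1; lra.
by apply: gliding_take; [|lra|lra|exact: gliding_skip].
Qed.

(** Apply the functional with slopes d: its value at s is at least m / 3, but s is
    nearly the projection of h, whose mean is 1, so that this value is at most
    K + m / 6. *)
Lemma bounded_projections_absurd : 0 <= K -> False.
Proof.
move=> K0; pose m := Num.bound (6 * K).
have mK : 6 * K < m%:R by apply: archi_boundP; rewrite mulr_ge0.
have eps0 : 0 < 1 / 30 :> R by lra.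
have [H [c [H0 cH]]] := gliding_states m eps0.
move=> [L [h [s [d [N [A [[hm hs d1 wd] hr ht]]]]]]].
have [phi bphi phid] := functional_with_slopes hF L d1.
have bpsi : bounded_functional K (fun x => phi (T A 0 N x)).
  split=> [b x y|x].
    by rewrite T_lin (functionalD bphi) (functionalZ bphi).
  by have [_ le1] := bphi; apply: le_trans (le1 _) _; rewrite mul1r; exact: a_proj.
have := functional_molecule_le hF bpsi L h.
have -> : mean L (fun i => `|h i|) = 1.
  rewrite -hm; apply: eq_mean => i _; rewrite ger0_norm//.
  by case: (hs i) => [->|[-> _ _]] //; exact: ltW.
have := hr _ bphi; rewrite (functionalB bphi) phid.
move: wd; move: (mean _ _) (phi _) => u v; rewrite !ler_norml; lra.
Qed.

End GlidingHump.

Theorem no_unconditional_basis (e : nat -> F) : ~ is_unconditional_basis e.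
Proof.
move=> /(unconditional_basis_projections p_gt0)[a [K [K0 a_lin a_cvg a_tail a_proj]]].
exact: (bounded_projections_absurd a_lin a_cvg a_tail a_proj K0).
Qed.

End NoUnconditionalBasis.

(** * Bases from commuting projections, and the dyadic numbers *)

Section SchauderFromProjections.
Variables (R : realType) (p : R).
Hypothesis p_gt0 : 0 < p.
Variables (X : pBanachType p) (Q : nat -> {linear X -> X}) (e : nat -> X) (C : R).
Hypothesis Q_bounded : forall n x, fnorm (Q n x) <= C * fnorm x.
Hypothesis Q0 : forall x, Q 0%N x = 0.
Hypothesis Q_absorbl : forall m n x, (m <= n)%N -> Q m (Q n x) = Q m x.
Hypothesis Q_absorbr : forall m n x, (m <= n)%N -> Q n (Q m x) = Q m x.
Hypothesis Q_cvg : forall x, fcvg (Q^~ x) x.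
Hypothesis Q_step : forall n x, exists c, Q n.+1 x - Q n x = c *: e n.
Hypothesis Q_on : forall n, Q n.+1 (e n) = e n.
Hypothesis Q_off : forall n, Q n (e n) = 0.
Hypothesis e_neq0 : forall n, e n != 0.

Let step_e n i : Q n.+1 (e i) - Q n (e i) = (i == n)%:R *: e n.
Proof.
have [ni|ni|->] := ltngtP n i.
- rewrite scale0r -(Q_absorbl _ ni) -(Q_absorbl _ (ltnW ni)).
  by rewrite Q_off (linear0 (Q n.+1)) (linear0 (Q n)) subrr.
- by rewrite scale0r -{1 2}(Q_on i)  (Q_absorbr _ ni) (Q_absorbr _ (leqW ni)) subrr.
- by rewrite Q_on Q_off subr0 scale1r.
Qed.

(** The expansion of x telescopes to Q n x; and the coefficient of e n in any
    expansion of x is recovered from Q n.+1 x - Q n x. *)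
Lemma schauder_basis_of_projections : is_schauder_basis e.
Proof.
move=> x; have /choice[c cP] := Q_step^~ x.
have sumc n : \sum_(0 <= i < n) c i *: e i = Q n x.
  elim: n => [|n IH]; first by rewrite big_geq// Q0.
  by rewrite big_nat_recr//= IH -cP addrC subrK.
exists c; split=> [|b /(pnorm_cvgP p_gt0) bx].
  by apply/(pnorm_cvgP p_gt0); under eq_fun do rewrite sumc; exact: Q_cvg.
apply/funext => n; suff /eqP : c n *: e n = b n *: e n.
  rewrite -subr_eq0 -scalerBl scaler_eq0 (negPf (e_neq0 n)) orbF subr_eq0.
  by move/eqP.
rewrite -cP; pose S N := \sum_(0 <= i < N) b i *: e i.
have QS : fcvg (fun N => Q n.+1 (S N) - Q n (S N)) (Q n.+1 x - Q n x).
  have h1 := bounded_fcvg (Q_bounded n.+1) bx.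
  have h2 := fcvgZ (-1) (bounded_fcvg (Q_bounded n) bx).
  have := fcvgD h1 h2; rewrite scaleN1r; congr fcvg; apply/funext => N.
  by rewrite scaleN1r.
apply: (fcvg_unique QS) => eps eps0; exists n.+1 => N nN.
have QZ m a v : Q m (a *: v) = a *: Q m v by rewrite linearZ.
suff -> : Q n.+1 (S N) - Q n (S N) = b n *: e n by rewrite subrr fnorm0.
rewrite /S (linear_sum (Q n.+1)) (linear_sum (Q n)) -sumrB /=.
rewrite big_mkord (bigD1 (Ordinal nN))//= big1.
  by rewrite addr0 !QZ -scalerBr step_e eqxx scale1r.
move=> i /negPf; rewrite -val_eqE /= => ni.
by rewrite !QZ -scalerBr step_e ni scale0r scaler0.
Qed.

End SchauderFromProjections.

Lemma fcvg_line (R : realType) (p : R) (p_gt0 : 0 < p) (X : pNormedType p)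
    (e : X) (c : nat -> R) (l : X) :
  fcvg (fun n => c n *: e) l -> exists b, l = b *: e.
Proof.
move=> cl; have [e0|/eqP/fnorm_gt0 e0] := eqVneq e 0.
  exists 0; rewrite scale0r; apply: (fcvg_unique cl) => eps eps0.
  by exists 0%N => n _; rewrite e0 scaler0 subrr fnorm0.
have [|b cb] := @real_cauchy_cvg R c.
  move=> eps eps0; have w0 : 0 < eps `^ p * fnorm e := mulr_gt0 (powR_gt0 p eps0) e0.
  have [N NP] := fcvg_cauchy cl w0; exists N => m n Nm Nn.
  have := NP m n Nm Nn; rewrite -scalerBl fnormZ ltr_pM2r//.
  by rewrite ltr_powp// ltW.
exists b; have ce := @fcvg_scale R p p_gt0 X c b e cb; exact: fcvg_unique cl ce.
Qed.

Section DyadicEnumeration.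
Variable R : realType.

(** The dyadic numbers of ]0, 1[, level by level: for N = n + 1 with
    2 ^ L <= N < 2 ^ L.+1, this is (2 (N - 2 ^ L) + 1) / 2 ^ L.+1. The simpler form
    makes the injectivity a matter of odd parts. *)
Definition dyadic (n : nat) : R :=
  n.+1.*2.+1%:R / 2 ^+ (trunc_log 2 n.+1).+1 - 1.

Lemma dyadicE L i : (i < 2 ^ L)%N ->
  exists n, dyadic n = i.*2.+1%:R / 2 ^+ L.+1.
Proof.
move=> iL; have L0 : (0 < 2 ^ L)%N by rewrite expn_gt0.
exists (2 ^ L + i).-1; rewrite /dyadic prednK ?addn_gt0 ?L0//.
have -> : trunc_log 2 (2 ^ L + i) = L.
  by apply: trunc_log_eq => //; rewrite leq_addr expnS mul2n -addnn ltn_add2l.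
rewrite doubleD -addnS natrD -mul2n -expnS natrX mulrDl divff ?gt_eqF ?exprn_gt0//.
by rewrite addrAC subrr add0r.
Qed.

Lemma dyadic_inj : injective dyadic.
Proof.
(* The odd parts of two equal numbers are equal. *)
have inj a b m n : (a <= b)%N ->
    (m.*2.+1 * 2 ^ b = n.*2.+1 * 2 ^ a)%N -> m.*2.+1 = n.*2.+1.
  move=> /subnK <-; rewrite expnD mulnA => /eqP.
  rewrite eqn_pmul2r ?expn_gt0// => /eqP E.
  have := congr1 odd E; rewrite oddM !oddS !odd_double /= => /esym.
  case: (b - a)%N E => [|k]; last by rewrite expnS mul2n odd_double.
  by rewrite expn0 muln1.
move=> m n /addIr E.
have {E} E : (m.+1.*2.+1 * 2 ^ (trunc_log 2 n.+1).+1 =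
    n.+1.*2.+1 * 2 ^ (trunc_log 2 m.+1).+1)%N.
  apply/eqP; rewrite -(eqr_nat R) !natrM !natrX.
  rewrite -eqr_div ?expf_neq0//. by apply/eqP.
suff : m.+1.*2.+1 = n.+1.*2.+1 by move=> [] /double_inj[].
by case: (leqP (trunc_log 2 m.+1).+1 (trunc_log 2 n.+1).+1) => [|/ltnW] le;
  [|symmetry]; exact: inj le _.
Qed.

Lemma dyadic_gt0_lt1 n : 0 < dyadic n < 1.
Proof.
have /andP[le lt] := trunc_log_bounds (isT : 1 < 2)%N (isT : 0 < n.+1)%N.
have L0 : 0 < 2 ^+ (trunc_log 2 n.+1).+1 :> R by rewrite exprn_gt0.
rewrite /dyadic subr_gt0 ltrBlDr ltr_pdivlMr// ltr_pdivrMr//.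
rewrite mul1r -[1 + 1]/(2%:R) -natrX -natrM !ltr_nat.
by move: le lt; rewrite expnS; move: (2 ^ _)%N => u; lia.
Qed.

Lemma dyadic_dense_left (x eps : R) : 0 < x -> x <= 1 -> 0 < eps ->
  exists n, x - eps < dyadic n <= x.
Proof.
move=> x0 x1 eps0; have m0 : 0 < Num.min x eps by rewrite lt_min x0.
have [L LP] := half_pow_small 1 m0.
have := LP L (leqnn L); rewrite lt_min => /andP[Lx Leps].
have L0 : 0 < 2 ^+ L :> R by rewrite exprn_gt0.
have xL1 : 1 <= x * 2 ^+ L by move: Lx; rewrite ltr_pdivrMr// => /ltW.
pose i := Num.truncn (x * 2 ^+ L - 1 / 2).
have pos : 0 <= x * 2 ^+ L - 1 / 2 by lra.
have /andP[le lt] := truncn_itv pos; rewrite -/i in le lt.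
have iL : (i < 2 ^ L)%N.
  rewrite -(ltr_nat R) natrX; apply: le_lt_trans le _.
  have : x * 2 ^+ L <= 2 ^+ L by rewrite ler_piMl// ltW.
  lra.
have [n nE] := dyadicE iL; exists n; rewrite nE.
have -> : i.*2.+1%:R / 2 ^+ L.+1 = (i%:R + 1 / 2) / 2 ^+ L :> R.
  by rewrite -natr1 -muln2 natrM exprS; field; rewrite gt_eqF.
rewrite ltr_pdivlMr// ler_pdivrMr//; apply/andP; split; last lra.
have : 1 < eps * 2 ^+ L by rewrite -ltr_pdivrMr.
by move: lt; rewrite -natr1 mulrBl; lra.
Qed.

End DyadicEnumeration.

(** * Piecewise affine interpolation *)

Section Interpolation.
Variables (R : realType) (p : R) (p_gt0 : 0 < p) (p_le1 : p <= 1).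
Local Notation I := (unit_interval p_gt0 p_le1).
Variables (F : pBanachType p) (delta : I -> F).
Hypothesis hF : is_lipschitz_free delta.
Local Notation curve := (curve delta).

(** The affine map from [a, b] to F through curve a and curve b *)
Definition chord (a b x : R) : F :=
  ((b - x) / (b - a)) *: curve a + ((x - a) / (b - a)) *: curve b.

Lemma chord_left a b : a < b -> chord a b a = curve a.
Proof.
move=> ab; rewrite /chord subrr mul0r scale0r addr0 divff ?scale1r//.
by rewrite subr_eq0 gt_eqF.
Qed.

Lemma chord_right a b : a < b -> chord a b b = curve b.
Proof.
move=> ab; rewrite /chord subrr mul0r scale0r add0r divff ?scale1r//.
by rewrite subr_eq0 gt_eqF.
Qed.

Lemma chordB a b x y : chord a b x - chord a b y =
  ((x - y) / (b - a)) *: (curve b - curve a).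
Proof.
have combB (s t s' t' : R) (u v : F) : (s *: u + t *: v) - (s' *: u + t' *: v) =
    (s - s') *: u + (t - t') *: v by rewrite opprD addrACA -!scalerBl.
rewrite /chord combB scalerBr [RHS]addrC -scaleNr.
by rewrite -!mulrBl -mulNr; congr (_ / _ *: _ + _ / _ *: _); ring.
Qed.

Lemma pnorm_chordB a b x y : 0 <= a -> a < b -> b <= 1 ->
  pnorm (chord a b x - chord a b y) = `|x - y|.
Proof.
move=> a0 ab b1; rewrite chordB pnormZ (curve_dist hF)
  ?a0 ?b1 ?(le_trans _ b1) ?(le_trans a0) ?ltW//.
have ba : 0 < b - a by lra.
by rewrite normrM normfV -mulrA mulVf ?mulr1// normr_eq0 gt_eqF.
Qed.

Lemma chord_chord c d a b x : c < d -> a < b ->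
  ((b - x) / (b - a)) *: chord c d a + ((x - a) / (b - a)) *: chord c d b = chord c d x.
Proof.
move=> cd ab; rewrite /chord !scalerDr !scalerA addrACA -!scalerDl.
by congr (_ *: _ + _ *: _); field; apply/andP; split; rewrite subr_eq0 gt_eqF.
Qed.

(** a and b are consecutive nodes of S. *)
Definition cell (S : seq R) (a b : R) : Prop :=
  [/\ a \in S, b \in S, a < b & forall z, z \in S -> z <= a \/ b <= z].

Definition net (S : seq R) : Prop :=
  (forall z, z \in S -> 0 <= z <= 1) /\
  (forall x, 0 <= x <= 1 -> exists a b, cell S a b /\ a <= x <= b).

(** Two cells that contain x are equal, or they are adjacent and x is their common
    node. *)
Lemma chord_cell_unique S a b c d x : cell S a b -> cell S c d ->
  a <= x <= b -> c <= x <= d -> chord a b x = chord c d x.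
Proof.
move=> [aS bS ab abS] [cS dS cd cdS] /andP[ax xb] /andP[cx xd].
have [ca|bc] := abS c cS; last first.
  have -> : x = b by lra.
  have -> : c = b by lra.
  by rewrite chord_right// chord_left//; lra.
have [ac|da] := cdS a aS; last first.
  have -> : x = a by lra.
  have -> : d = a by lra.
  by rewrite chord_left// chord_right//; lra.
have -> : c = a by lra.
have [db|bd] := abS d dS; first (exfalso; lra).
have [bc|] := cdS b bS; first (exfalso; lra).
by move=> db; have -> : d = b by lra.
Qed.

(** From x to the next node, from there to the node before y, and from there to y: on
    each of these three parts f is an isometry onto its image or agrees with
    curve at both ends, and each part is no longer than `|x - y|. *)
Lemma lipschitz_of_cells S (f : R -> F) x y : net S ->
  (forall a b x, cell S a b -> a <= x <= b -> f x = chord a b x) ->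
  0 <= x <= 1 -> 0 <= y <= 1 -> x <= y ->
  fnorm (f x - f y) <= 3 * `|x - y| `^ p.
Proof.
move=> [S01 Scell] fE x01 y01 xy.
have [a [b [ab axb]]] := Scell x x01; have [c [d [cd cyd]]] := Scell y y01.
have [/S01/andP[a0 _] bS alb abS] := ab; have /andP[b0 b1] := S01 _ bS.
have [cS dS cld cdS] := cd; have /andP[c0 c1] := S01 _ cS; have /andP[d0 d1] := S01 _ dS.
have /andP[ax xb] := axb; have /andP[cy yd] := cyd.
have D0 := powR_ge0 `|x - y| p.
have one u v s t : cell S u v -> 0 <= u -> v <= 1 -> u < v ->
    u <= s <= v -> u <= t <= v -> `|s - t| <= `|x - y| ->
    fnorm (f s - f t) <= `|x - y| `^ p.
  move=> uv u0 v1 ulv su tu st; rewrite !(fE _ _ _ uv)// /fnorm pnorm_chordB//.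
  by rewrite ler_powp.
have [yb|by_] := leP y b.
  have := one a b x y ab a0 b1 alb axb; rewrite yb (le_trans ax xy) => /(_ isT (lexx _)).
  lra.
(* b is a node between x and y, and then so is c *)
have bc : b <= c by have [|] := cdS b bS; lra.
have h1 := one a b x b ab a0 b1 alb axb.
have h3 := one c d c y cd c0 d1 cld.
have h2 : fnorm (f b - f c) <= `|x - y| `^ p.
  have -> : f b = curve b by rewrite (fE a b)// ?chord_right// lexx ltW.
  have -> : f c = curve c by rewrite (fE c d)// ?chord_left// lexx ltW.
  rewrite /fnorm (curve_dist hF) ?b0 ?c0// ler_powp//.
  by rewrite distrC [leRHS]distrC !ger0_norm; lra.
have {}h1 : fnorm (f x - f b) <= `|x - y| `^ p.
  by apply: h1; [rewrite lexx ltW|rewrite distrC [leRHS]distrC !ger0_norm; lra].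
have {}h3 : fnorm (f c - f y) <= `|x - y| `^ p.
  by apply: h3 => //; [rewrite lexx ltW|rewrite distrC [leRHS]distrC !ger0_norm; lra].
have := fnorm_dist (f b) (f x) (f y); have := fnorm_dist (f c) (f b) (f y); lra.
Qed.

Lemma interpolation S : net S -> 0 \in S -> exists P : {linear F -> F},
  (forall v, fnorm (P v) <= 3 * fnorm v) /\
  forall a b x, cell S a b -> a <= x <= b -> P (curve x) = chord a b x.
Proof.
move=> netS S0; have [S01 Scell] := netS.
have /choice[g gP] : forall x, exists v, 0 <= x <= 1 ->
    forall a b, cell S a b -> a <= x <= b -> v = chord a b x.
  move=> x; have [x01|] := boolP (0 <= x <= 1); last by exists 0.
  have [a [b [ab axb]]] := Scell x x01; exists (chord a b x) => _ c d cd cxd.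
  exact: chord_cell_unique ab cd axb cxd.
have cell01 a b x : cell S a b -> a <= x <= b -> 0 <= x <= 1.
  move=> [/S01/andP[a0 _] /S01/andP[_ b1] _ _] /andP[ax xb].
  by rewrite (le_trans a0 ax) (le_trans xb b1).
have gE a b x : cell S a b -> a <= x <= b -> g x = chord a b x.
  by move=> ab axb; apply: gP => //; exact: cell01 ab axb.
have K0 : 0 <= 3 `^ p^-1 :> R := powR_ge0 _ _.
have glip x y : 0 <= x <= 1 -> 0 <= y <= 1 -> pnorm (g x - g y) <= 3 `^ p^-1 * `|x - y|.
  move=> x01 y01; rewrite -(ler_powp p_gt0) ?pnorm_ge0 ?mulr_ge0//.
  rewrite powRM// powpVK// -/(fnorm (g x - g y)).
  have [xy|/ltW yx] := leP x y; first exact: lipschitz_of_cells netS gE x01 y01 xy.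
  by rewrite fnormC distrC; exact: lipschitz_of_cells netS gE y01 x01 yx.
have [||P [Pd Pn]] := @free_extension R p I F delta hF F (fun t : I => g (sval t)) _ K0.
- by move=> s t; apply: glip; exact: sval01.
- have z01 : 0 <= (0 : R) <= 1 by rewrite lexx ler01.
  have [a [b [ab a0b]]] := Scell 0 z01.
  rewrite -[sval _]/(0 : R) (gE a b)//.
  have [/S01/andP[a0 _] _ alb _] := ab; have -> : 0 = a by lra.
  rewrite chord_left//; have -> : a = 0 by lra.
  exact: curve0.
exists P; split=> [v|a b x ab axb].
  by have := bounded_fnorm p_gt0 K0 Pn v; rewrite powpVK.
by rewrite Pd val_point ?(cell01 a b)// (gE a b).
Qed.

Lemma net_cons S x : net S -> 0 <= x <= 1 -> net (x :: S).
Proof.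
move=> [S01 Scell] x01; split=> [z|y y01].
  by rewrite inE => /predU1P[->//|]; exact: S01.
have [a [b [[aS bS ab abS] /andP[ay yb]]]] := Scell y y01.
have [xa|ax] := leP x a.
  exists a, b; split; last by rewrite ay.
  split; rewrite ?inE ?aS ?bS ?orbT//.
  by move=> z; rewrite inE => /predU1P[->|/abS//]; left.
have [bx|xb] := leP b x.
  exists a, b; split; last by rewrite ay.
  split; rewrite ?inE ?aS ?bS ?orbT//.
  by move=> z; rewrite inE => /predU1P[->|/abS//]; right.
have [xy|/ltW yx] := leP x y.
  exists x, b; split; last by rewrite xy.
  split; rewrite ?inE ?eqxx ?bS ?orbT//.
  move=> z; rewrite inE => /predU1P[->|/abS[za|]]; [by left| |by right].
  by left; exact: le_trans za (ltW ax).
exists a, x; split; last by rewrite ay.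
split; rewrite ?inE ?eqxx ?aS ?orbT//.
move=> z; rewrite inE => /predU1P[->|/abS[|bz]]; [by right|by left|].
by right; exact: le_trans (ltW xb) bz.
Qed.

Section TwoNets.
Variables (S S' : seq R) (P P' : {linear F -> F}).
Hypotheses (netS : net S) (netS' : net S') (SS' : {subset S <= S'}).
Hypothesis PE : forall a b x, cell S a b -> a <= x <= b -> P (curve x) = chord a b x.
Hypothesis P'E : forall a b x, cell S' a b -> a <= x <= b -> P' (curve x) = chord a b x.

Lemma interpolation_node z : z \in S -> P (curve z) = curve z.
Proof.
move=> zS; have [S01 Scell] := netS.
have [a [b [ab azb]]] := Scell z (S01 z zS); rewrite (PE ab azb).
have [_ _ alb abS] := ab; have [za|bz] := abS z zS.
  by have ->: z = a; [lra|rewrite chord_left].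
by have ->: z = b; [lra|rewrite chord_right].
Qed.

(** The chord map of S is affine on the cells of the finer net S'. *)
Lemma interpolation_coarse_fine x : 0 <= x <= 1 -> P (P' (curve x)) = P (curve x).
Proof.
move=> x01; have [S01 Scell] := netS; have [S'01 S'cell] := netS'.
have [a [b [ab axb]]] := S'cell x x01; have [aS' bS' alb abS] := ab.
have /andP[a0 a1] := S'01 a aS'; have /andP[b0 b1] := S'01 b bS'.
(* The cell of S around the midpoint contains the whole cell of S', since no
   node of S lies strictly between a and b. *)
have m01 : 0 <= (a + b) / 2 <= 1 by lra.
have [c [d [cd cmd]]] := Scell _ m01; have [cS dS cld cdS] := cd.
have ca : c <= a by have [] := abS c (SS' cS); lra.
have bd : b <= d by have [] := abS d (SS' dS); lra.
rewrite (P'E ab axb) /chord linearD !linearZ /=.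
rewrite (PE cd (_ : c <= a <= d)); last lra.
rewrite (PE cd (_ : c <= b <= d)); last lra.
by rewrite chord_chord// -(PE cd)//; lra.
Qed.

Lemma interpolation_fine_coarse x : 0 <= x <= 1 ->
  (forall z, z \in S' -> P' (curve z) = curve z) -> P' (P (curve x)) = P (curve x).
Proof.
move=> x01 P'node; have [_ Scell] := netS.
have [a [b [ab axb]]] := Scell x x01; have [aS bS _ _] := ab.
by rewrite (PE ab axb) /chord linearD !linearZ /= !P'node// SS'.
Qed.

End TwoNets.

(** Bounded operators are determined by their values on the curve. *)
Lemma eq_of_curve (T U : {linear F -> F}) (C D : R) :
  (forall v, fnorm (T v) <= C * fnorm v) -> (forall v, fnorm (U v) <= D * fnorm v) ->
  (forall x, 0 <= x <= 1 -> T (curve x) = U (curve x)) -> forall v, T v = U v.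
Proof.
move=> TC UD TU; apply: (free_closed_subspaceT p_gt0 hF (S := fun v => T v = U v)).
- by rewrite !linear0.
- by move=> a u v Tu Tv; rewrite !linearP Tu Tv.
- move=> u l Tu ul; apply: (fcvg_unique (bounded_fcvg TC ul)).
  have := bounded_fcvg UD ul; congr fcvg; apply/funext => n; exact/esym.
- by move=> t; have := TU (sval t) (sval01 t); rewrite /curve pointK.
Qed.

Lemma rank_one_of_curve (T : {linear F -> F}) (C : R) (w : F) :
  (forall v, fnorm (T v) <= C * fnorm v) ->
  (forall x, 0 <= x <= 1 -> exists c, T (curve x) = c *: w) ->
  forall v, exists c, T v = c *: w.
Proof.
move=> TC Tc; apply: (free_closed_subspaceT p_gt0 hF (S := fun v => exists c, T v = c *: w)).
- by exists 0; rewrite linear0 scale0r.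
- move=> a u v [b Tu] [c Tv]; exists (a * b + c).
  by rewrite linearP Tu Tv scalerDl scalerA.
- move=> u l /choice[c Tu] ul; apply: (fcvg_line p_gt0 (c := c)).
  by have := bounded_fcvg TC ul; congr fcvg; apply/funext.
- by move=> t; have := Tc (sval t) (sval01 t); rewrite /curve pointK.
Qed.

Lemma curve_not_on_chord a b x : 0 <= a -> a < x -> x < b -> b <= 1 ->
  curve x - chord a b x != 0.
Proof.
move=> a0 ax xb b1.
(* t |-> |t - x| - x is 1-Lipschitz, convex, and not affine at x *)
have [|||phi [bphi phiE]] := @functional_extension R p p_gt0 p_le1
  F delta hF (fun t => `|t - x| - x) 1.
- exact: ler01.
- by rewrite sub0r normrN ger0_norm ?subrr//; lra.
- move=> s t s0 st t1; rewrite mul1r opprB addrA subrK.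
  have := ler_dist_dist (t - x) (s - x).
  have -> : t - x - (s - x) = t - s by ring.
  by rewrite (@ger0_norm _ (t - s)) ?subr_ge0.
apply/negP => /eqP/(congr1 phi).
rewrite (functional0 bphi) (functionalB bphi) /chord (functionalD bphi) !(functionalZ bphi).
rewrite !phiE; [|lra|lra|lra].
rewrite subrr normr0 sub0r distrC !ger0_norm; [|lra|lra].
have ba : b - a != 0 by rewrite subr_eq0 gt_eqF//; lra.
have -> : - x - ((b - x) / (b - a) * (x - a - x) + (x - a) / (b - a) * (b - x - x)) =
   - (2 * ((b - x) * (x - a) / (b - a))) by field.
have : 0 < (b - x) * (x - a) / (b - a) by rewrite divr_gt0 ?mulr_gt0//; lra.
lra.
Qed.

End Interpolation.

(** * The Faber-Schauder basis *)

Section SchauderBasis.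
Variables (R : realType) (p : R) (p_gt0 : 0 < p) (p_le1 : p <= 1).
Local Notation I := (unit_interval p_gt0 p_le1).
Variables (F : pBanachType p) (delta : I -> F).
Hypothesis hF : is_lipschitz_free delta.
Local Notation curve := (curve delta).

Fixpoint dyadic_net (n : nat) : seq R :=
  if n is m.+1 then dyadic R m :: dyadic_net m else [:: 0; 1].

Lemma dyadic01W n : 0 <= dyadic R n <= 1.
Proof. by have /andP[x0 x1] := dyadic_gt0_lt1 R n; rewrite !ltW. Qed.

Lemma dyadic_netP n : net (dyadic_net n).
Proof.
elim: n => [|n IH]; last exact: net_cons IH (dyadic01W n).
split=> [z|x x01]; first by rewrite !inE => /orP[] /eqP ->; rewrite ?lexx ?ler01.
exists 0, 1; split=> //; split; rewrite ?inE ?eqxx ?orbT// => z.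
by rewrite !inE => /orP[] /eqP ->; [left|right].
Qed.

Lemma dyadic_net_sub m n : (m <= n)%N -> {subset dyadic_net m <= dyadic_net n}.
Proof.
move=> /subnK <-; elim: (n - m)%N => // k IH z /IH zk.
by rewrite addSn /= inE zk orbT.
Qed.

Lemma dyadic_net0 n : 0 \in dyadic_net n.
Proof. by apply: (dyadic_net_sub (leq0n n)); rewrite !inE eqxx. Qed.

Lemma dyadic_mem_net m n : (m < n)%N -> dyadic R m \in dyadic_net n.
Proof. by move=> /dyadic_net_sub; apply; rewrite /= inE eqxx. Qed.

(** A repeated node would give a zero vector in the basis. *)
Lemma dyadic_fresh n : dyadic R n \notin dyadic_net n.
Proof.
suff H m : (m <= n)%N -> dyadic R n \notin dyadic_net m by exact: H.
have /andP[x0 x1] := dyadic_gt0_lt1 R n.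
elim: m => [_|m IH mn] /=; first by rewrite !inE gt_eqF// lt_eqF.
rewrite inE negb_or IH ?(ltnW mn)// andbT.
by apply/eqP => /dyadic_inj E; rewrite E ltnn in mn.
Qed.

Section Projections.
Variable P : nat -> {linear F -> F}.
Hypothesis P_bounded : forall n v, fnorm (P n v) <= 3 * fnorm v.
Hypothesis P_chord : forall n a b x, cell (dyadic_net n) a b -> a <= x <= b ->
  P n (curve x) = chord delta a b x.

Let P_node n z : z \in dyadic_net n -> P n (curve z) = curve z.
Proof. exact: (interpolation_node (dyadic_netP n) (P_chord (n := n))). Qed.

Let PP_bounded m n v : fnorm (P m (P n v)) <= 9 * fnorm v.
Proof.
by apply: le_trans (P_bounded _ _) _; have := P_bounded n v; lra.
Qed.

Lemma projections_absorbl m n v : (m <= n)%N -> P m (P n v) = P m v.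
Proof.
move=> mn; move: v; apply: (eq_of_curve hF (T := P m \o P n) (C := 9) (D := 3)) => //.
  by move=> v; exact: PP_bounded.
move=> x x01; exact: (interpolation_coarse_fine (dyadic_netP m) (dyadic_netP n)
  (dyadic_net_sub mn) (P_chord (n := m)) (P_chord (n := n))).
Qed.

Lemma projections_absorbr m n v : (m <= n)%N -> P n (P m v) = P m v.
Proof.
move=> mn; move: v; apply: (eq_of_curve hF (T := P n \o P m) (C := 9) (D := 3)) => //.
  by move=> v; exact: PP_bounded.
move=> x x01; apply: (interpolation_fine_coarse (dyadic_netP m)
  (dyadic_net_sub mn) (P_chord (n := m))) => // z; exact: P_node.
Qed.

Let P_cvg_curve x : 0 <= x <= 1 -> fcvg (fun n => P n (curve x)) (curve x).
Proof.
move=> x01 eps eps0; have [x00|xn0] := eqVneq x 0.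
  exists 0%N => n _; rewrite x00 P_node ?dyadic_net0// subrr.
  by rewrite fnorm0.
have /andP[x0 x1] := x01.
have {x0} xgt0 : 0 < x by rewrite lt_neqAle eq_sym xn0.
pose eta := (eps / 2) `^ p^-1.
have eta0 : 0 < eta by rewrite powR_gt0//; lra.
have [N /andP[xN Nx]] := dyadic_dense_left xgt0 x1 eta0.
exists N.+1 => n Nn; have zn := dyadic_mem_net Nn.
have [S01 Scell] := dyadic_netP n.
have [a [b [ab axb]]] := Scell x x01.
have [aS bS alb /(_ _ zn)] := ab.
have /andP[a0 _] := S01 a aS; have /andP[_ b1] := S01 b bS.
have /andP[ax xb] := axb.
case=> [Na|bN]; last first.
  have xS : x \in dyadic_net n by have -> : x = b by lra.
  by rewrite P_node// subrr fnorm0.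
rewrite (P_chord ab axb).
have near (v w : F) : pnorm (v - w) = `|x - a| -> fnorm (v - w) < eps / 2.
  move=> vw; have -> : eps / 2 = eta `^ p by rewrite /eta powpVK//; lra.
  by rewrite /fnorm vw ltr_powp// ?(ltW eta0)// ger0_norm; lra.
have h1 : fnorm (chord delta a b x - curve a) < eps / 2.
  by apply: near; rewrite -(chord_left delta alb) (pnorm_chordB hF).
have h2 : fnorm (curve a - curve x) < eps / 2.
  rewrite fnormC; apply: near; rewrite (curve_dist hF)//.
  by rewrite a0; lra.
have := fnorm_dist (curve a) (chord delta a b x) (curve x); lra.
Qed.

Lemma projections_cvg v : fcvg (fun n => P n v) v.
Proof.
move: v; apply: (free_closed_subspaceT p_gt0 hF (S := fun v => fcvg (fun n => P n v) v)).
- move=> eps eps0; exists 0%N => n _.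
  by rewrite linear0 subrr fnorm0.
- move=> a u v Pu Pv; have := fcvgD (fcvgZ a Pu) Pv; congr fcvg.
  by apply/funext => n; rewrite linearP.
- move=> u l Pu ul eps eps0; have eps6 : 0 < eps / 6 by lra.
  have [k /(_ k (leqnn k)) kP] := ul _ eps6.
  have [N NP] := Pu k _ eps6; exists N => n /NP Nn.
  have := P_bounded n (l - u k); rewrite linearB (fnormC l) => Pl.
  have := fnorm_dist (P n (u k)) (P n l) l; have := fnorm_dist (u k) (P n (u k)) l.
  lra.
- by move=> t; have := P_cvg_curve (sval01 t); rewrite /curve pointK.
Qed.

(** The difference between the new node and the old chord; its coordinate functional
    is the hat function of this node. *)
Definition faber_schauder n : F :=
  if n is m.+1 then curve (dyadic R m) - P m (curve (dyadic R m)) else curve 1.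

Let Q n : {linear F -> F} := if n is m.+1 then P m else \0.

Lemma projections_step n v : exists c, Q n.+1 v - Q n v = c *: faber_schauder n.
Proof.
case: n => [|n]; rewrite [Q _]/=.
  suff [c Pc] : exists c, P 0%N v = c *: curve 1 by exists c; rewrite /= subr0.
  apply: (rank_one_of_curve hF (P_bounded 0%N)) => x x01; exists x.
  rewrite (P_chord (n := 0%N) (a := 0) (b := 1))//; last first.
    split; rewrite ?inE ?eqxx ?orbT// => z.
    by rewrite !inE => /orP[] /eqP ->; [left|right].
  by rewrite /chord (curve0 hF) scaler0 add0r !subr0 divr1.
apply: (rank_one_of_curve hF (T := P n.+1 \- P n) (C := 6)) => [u|x x01] /=.
  by have := fnormB (P n.+1 u) (P n u); have := P_bounded n u; have := P_bounded n.+1 u; lra.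
have [_ Scell] := dyadic_netP n.+1; have [a [b [ab axb]]] := Scell x x01.
have node z : z \in dyadic_net n.+1 ->
    exists c, curve z - P n (curve z) = c *: faber_schauder n.+1.
  rewrite /= inE => /predU1P[->|zn]; first by exists 1; rewrite scale1r.
  by exists 0; rewrite P_node// subrr scale0r.
have [aS bS _ _] := ab; have [ca Ea] := node a aS; have [cb Eb] := node b bS.
rewrite -(projections_absorbl (curve x) (leqnSn n)) (P_chord ab axb) /chord.
exists ((b - x) / (b - a) * ca + (x - a) / (b - a) * cb).
rewrite linearD !linearZ /= opprD addrACA -!scalerBr Ea Eb.
by rewrite scalerDl !scalerA.
Qed.

Lemma faber_schauder_neq0 n : faber_schauder n != 0.
Proof.
case: n => [|n] /=.
  apply/eqP => c1; have := curve_dist hF (x := 1) (y := 0).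
  rewrite c1 (curve0 hF) subrr pnorm0 subr0 normr1 ler01 !lexx => /(_ isT isT)/esym/eqP.
  by rewrite oner_eq0.
have x01 := dyadic01W n.
have [S01 Scell] := dyadic_netP n; have [a [b [ab axb]]] := Scell _ x01.
rewrite (P_chord ab axb); have [aS bS _ _] := ab.
have /andP[a0 _] := S01 a aS; have /andP[_ b1] := S01 b bS.
have /andP[ax xb] := axb; have fresh := dyadic_fresh n.
apply: (curve_not_on_chord hF) => //; rewrite lt_neqAle ?ax ?xb andbT.
  by apply: contra fresh => /eqP <-.
by apply: contra fresh => /eqP ->.
Qed.

Lemma faber_schauder_basis : is_schauder_basis faber_schauder.
Proof.
apply: (@schauder_basis_of_projections R p p_gt0 F Q _ 3).
- by case=> [|n] v /=; rewrite ?fnorm0 ?mulr_ge0 ?fnorm_ge0.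
- by [].
- case=> [|m] [|n] v //= mn; exact: projections_absorbl.
- case=> [|m] [|n] v //= mn; first exact: linear0.
  exact: projections_absorbr.
- move=> v eps eps0; have [N NP] := projections_cvg v eps0.
  by exists N.+1 => -[//|n]; rewrite ltnS; exact: NP.
- exact: projections_step.
- case=> [|n] /=; first by rewrite P_node// !inE eqxx orbT.
  rewrite linearB /= projections_absorbr// (@P_node n.+1)//.
  exact: dyadic_mem_net.
- by case=> [|n] //=; rewrite linearB /= projections_absorbl// subrr.
- exact: faber_schauder_neq0.
Qed.

End Projections.

Theorem has_schauder_basis : exists e : nat -> F, is_schauder_basis e.
Proof.
have /choice[P PP] : forall n, exists P : {linear F -> F},
    (forall v, fnorm (P v) <= 3 * fnorm v) /\
    forall a b x, cell (dyadic_net n) a b -> a <= x <= b ->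
      P (curve x) = chord delta a b x.
  by move=> n; have := interpolation hF (dyadic_netP n) (dyadic_net0 n).
exists (faber_schauder P); apply: faber_schauder_basis.
  by move=> n; have [] := PP n.
by move=> n; have [] := PP n.
Qed.

End SchauderBasis.

(** * Bases of the free space over the unit interval *)

Theorem mainTheorem6 (R : realType) (p : R) (hp0 : 0 < p) (hp1 : p < 1)
    (F : pBanachType p) (delta : unit_interval hp0 (ltW hp1) -> F)
    (hF : is_lipschitz_free delta) :
  (exists e : nat -> F, is_schauder_basis e) /\
  ~ (exists e : nat -> F, is_unconditional_basis e).
Proof.
split; first exact: has_schauder_basis hF.
by move=> [e]; exact: no_unconditional_basis hF e.
Qed.
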